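(* Let $\mathcal{A}$ be a unital $C^*$-algebra and $\mathcal{H}$ a finite-dimensional complex Hilbert space. Then for every positive operator $P\in\mathscr{B}(\mathcal{H})$, the set $\mathrm{CP}^{(P)}(\mathcal{A},\mathscr{B}(\mathcal{H}))$ equals the closure, in the BW-topology on $\mathrm{CP}(\mathcal{A},\mathscr{B}(\mathcal{H}))$, of the $P$-$C^*$-convex hull of the set of $P$-$C^*$-extreme points of $\mathrm{CP}^{(P)}(\mathcal{A},\mathscr{B}(\mathcal{H}))$.
   Context: $\mathscr{B}(\mathcal{H})$ is the algebra of bounded linear operators on $\mathcal{H}$; $1$ is the unit of $\mathcal{A}$. ''CP'' means completely positive (linear); $\mathrm{CP}(\mathcal{A},\mathscr{B}(\mathcal{H}))$ is the set of all CP maps $\mathcal{A}\to\mathscr{B}(\mathcal{H})$. For $T\in\mathscr{B}(\mathcal{H})$, $\mathrm{Ad}_T(X):=T^*XT$. For a positive operator $P$, $\mathrm{CP}^{(P)}(\mathcal{A},\mathscr{B}(\mathcal{H}))$ is the set of all CP maps $\Phi:\mathcal{A}\to\mathscr{B}(\mathcal{H})$ with $\Phi(1)=P$. A map $\Phi\in\mathrm{CP}^{(P)}(\mathcal{A},\mathscr{B}(\mathcal{H}))$ is a $P$-$C^*$-extreme point of this set if whenever $\Phi=\sum_{j=1}^n\mathrm{Ad}_{T_j}\circ\Phi_j$ with $n\ge 1$, $\Phi_j\in\mathrm{CP}^{(P)}(\mathcal{A},\mathscr{B}(\mathcal{H}))$ and $T_j\in\mathscr{B}(\mathcal{H})$ invertible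 with $\sum_{j=1}^nT_j^*PT_j=P$, there exist invertible $S_j\in\mathscr{B}(\mathcal{H})$ such that $\Phi_j=\mathrm{Ad}_{S_j}\circ\Phi$ for all $1\leq j\leq n$. For $\mathcal{S}\subseteq\mathrm{CP}(\mathcal{A},\mathscr{B}(\mathcal{H}))$, its $P$-$C^*$-convex hull is the set of all $\sum_{j=1}^n\mathrm{Ad}_{T_j}\circ\Phi_j$ with $n\geq1$, $\Phi_j\in\mathcal{S}$, and $T_j\in\mathscr{B}(\mathcal{H})$ (not necessarily invertible) satisfying $\sum_{j=1}^nT_j^*PT_j=P$. The BW (bounded-weak) topology is the usual weak* topology on the space of bounded linear maps $\mathcal{A}\to\mathscr{B}(\mathcal{H})$; on norm-bounded sets (such as $\mathrm{CP}^{(P)}(\mathcal{A},\mathscr{B}(\mathcal{H}))$) a net $\Phi_\alpha$ converges to $\Phi$ in it iff $\Phi_\alpha(a)\to\Phi(a)$ in the weak operator topology for every $a\in\mathcal{A}$. *)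

(* Defs.v *)
From HB Require Import structures.
From mathcomp Require Import all_boot all_order all_algebra.
From mathcomp Require Import sesquilinear complex.
From mathcomp Require Import all_classical all_reals all_analysis.

Set Implicit Arguments.
Unset Strict Implicit.
Unset Printing Implicit Defensive.

Import Order.TTheory GRing.Theory Num.Theory Num.Def.
Import numFieldNormedType.Exports.

Local Open Scope classical_set_scope.
Local Open Scope ring_scope.
Local Open Scope complex_scope.

(* The norm is part of the mixin because the norm classes of the libraries
   have no join with non-commutative rings. *)
HB.mixin Record isCStar (R : realType) A & GRing.Algebra R[i] A := {
  cstar : A -> A;
  cnorm : A -> R;
  cstarK : involutive cstar;
  cstarD : {morph cstar : a b / a + b};
  cstarZ : forall (c : R[i]) (a : A), cstar (c *: a) = conjC c *: cstar a;
  cstarM : forall a b : A, cstar (a * b) = cstar b * cstar a;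
  cnorm_eq0 : forall a : A, cnorm a = 0 -> a = 0;
  cnormD : forall a b : A, cnorm (a + b) <= cnorm a + cnorm b;
  cnormZ : forall (c : R[i]) (a : A), (cnorm (c *: a))%:C = `|c| * (cnorm a)%:C;
  cnormM : forall a b : A, cnorm (a * b) <= cnorm a * cnorm b;
  cnorm_cstar : forall a : A, cnorm (cstar a * a) = cnorm a ^+ 2;
  cnorm_complete : forall u : nat -> A,
    (forall e : R, 0 < e -> exists N : nat, forall m n : nat,
       (N <= m)%N -> (N <= n)%N -> cnorm (u m - u n) < e) ->
    exists l : A, forall e : R, 0 < e -> exists N : nat, forall n : nat,
       (N <= n)%N -> cnorm (u n - l) < e
}.

#[short(type="unitalCStarType")]
HB.structure Definition UnitalCStar (R : realType) :=
  {A of GRing.Algebra R[i] A & isCStar R A}.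

Section Operators.
Variables (R : realType) (H : vectType R[i]) (dot : {dot H for conjC}).
Implicit Types (T X P : 'End(H)) (u v h : H).

Definition hnorm (v : H) : R := Num.sqrt (complex.Re (dot v v)).

Definition pos_op (P : 'End(H)) : Prop := forall h : H, 0 <= dot (P h) h.

Definition invertible_op (T : 'End(H)) : Prop :=
  exists S : 'End(H), (S \o T)%VF = \1%VF /\ (T \o S)%VF = \1%VF.

(* The default value 0 is never used: see adjopP. *)
Definition adjop (T : 'End(H)) : 'End(H) :=
  xget 0 [set S : 'End(H) | forall u v : H, dot (T u) v = dot u (S v)].

Lemma riesz (f : H -> R[i]) : scalar f -> exists w : H, forall u, f u = dot u w.
Proof.
move=> fL.
pose b : (\dim {:H}).-tuple H := vbasis fullv.
pose G := \matrix_(i, j) dot b`_i b`_j : 'M[R[i]]_(\dim {:H}).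
have bE u : u = \sum_i coord b i u *: b`_i.
  by apply: coord_vbasis; rewrite memvf.
have sumD (g : H -> R[i]) (gL : scalar g) n (x : 'I_n -> R[i]) (y : 'I_n -> H) :
    g (\sum_i x i *: y i) = \sum_i x i * g (y i).
  have g0 : g 0 = 0.
    by have := gL (-1) 0 0; rewrite scaler0 addr0 mulN1r addNr.
  have gZ c z : g (c *: z) = c * g z.
    by have := gL c z 0; rewrite addr0 g0 addr0.
  have gD z t : g (z + t) = g z + g t.
    by have := gL 1 z t; rewrite scale1r mul1r.
  by rewrite (big_morph g gD g0); apply: eq_bigr => i _; rewrite gZ.
have dotL w : scalar (dot^~ w) by move=> c x y /=; rewrite linearPl.
have Gu : G \in unitmx.
  rewrite -row_free_unit -kermx_eq0; apply/rowV0P => x /sub_kermxP xG.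
  pose y := \sum_i x 0 i *: b`_i.
  have yb (j : 'I_(\dim {:H})) : dot y b`_j = 0.
    transitivity ((x *m G) 0 j); last by rewrite xG mxE.
    by rewrite (sumD _ (dotL _)) mxE; apply: eq_bigr => i _; rewrite mxE.
  have y0 : y = 0.
    apply/eqP; rewrite -(dnorm_eq0 dot) {2}(bE y) linear_sumr /= big1 // => i _.
    by rewrite linearZr_LR /= yb mulr0.
  have /freeP fb : free b by exact: (basis_free (vbasisP _)).
  by apply/rowP => i; rewrite mxE; apply: fb.
pose c : 'cV_(\dim {:H}) := invmx G *m \col_i f b`_i.
exists (\sum_j conjC (c j 0) *: b`_j) => u.
rewrite {1}(bE u) {2}(bE u) (sumD _ fL) (sumD _ (dotL _)).
apply: eq_bigr => i _; congr (_ * _).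
have /colP/(_ i) : G *m c = \col_i f b`_i by rewrite mulKVmx.
rewrite !mxE => <-; rewrite linear_sumr /=; apply: eq_bigr => j _.
by rewrite linearZr_LR /= conjCK mxE mulrC.
Qed.

Lemma adjopP (T : 'End(H)) (u v : H) : dot (T u) v = dot u (adjop T v).
Proof.
suff [S SP] : exists S : 'End(H), forall u v, dot (T u) v = dot u (S v).
  by rewrite /adjop; case: xgetP => [S' _ /= ->//|/(_ S)].
have /choice[S SP] v' : exists w, forall u, dot (T u) v' = dot u w.
  by apply: riesz => c x y; rewrite linearP linearPl.
have dot_inj x y : (forall u, dot u x = dot u y) -> x = y.
  move=> xy; apply/eqP; rewrite -subr_eq0 -(dnorm_eq0 dot) linearBr /=.
  by rewrite xy subrr.
have SL : linear S.
  move=> c x y; apply: dot_inj => z.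
  by rewrite -SP !linearPr /= -!SP.
pose SM := GRing.isLinear.Build _ _ _ _ S SL.
pose Sl : {linear H -> H} := HB.pack S SM.
by exists (linfun Sl) => x y; rewrite lfunE SP.
Qed.

(* Ad_T(X) = T* X T *)
Definition Ad (T X : 'End(H)) : 'End(H) := (adjop T \o (X \o T))%VF.

End Operators.

Section CompletelyPositive.
Variables (R : realType) (A : unitalCStarType R).
Variables (H : vectType R[i]) (dot : {dot H for conjC}).

(* the involution of the C*-algebra M_k(A) *)
Definition mxstar k (X : 'M[A]_k) : 'M[A]_k := \matrix_(i, j) cstar (X j i).

Definition pos_mx k (X : 'M[A]_k) : Prop :=
  exists Y : 'M[A]_k, X = mxstar Y *m Y.

(* The amplification [Phi(X i j)]_(i, j) is an operator on the direct sum of k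
   copies of H; positivity of its quadratic form is spelled out in terms of the
   components of the vectors. *)
Definition pos_amplification k (Phi : A -> 'End(H)) (X : 'M[A]_k) : Prop :=
  forall h : 'I_k -> H, 0 <= \sum_i \sum_j dot (Phi (X i j) (h j)) (h i).

Definition CP : set (A -> 'End(H)) :=
  [set Phi | linear Phi /\
    forall k (X : 'M[A]_k), pos_mx X -> pos_amplification Phi X].

Definition CPP (P : 'End(H)) : set (A -> 'End(H)) :=
  [set Phi | CP Phi /\ Phi 1 = P].

Definition Cstar_sum n (T : 'I_n -> 'End(H)) (Phi : 'I_n -> A -> 'End(H)) :
  A -> 'End(H) := fun a => \sum_(j < n) Ad dot (T j) (Phi j a).

Definition Cstar_coeffs (P : 'End(H)) n (T : 'I_n -> 'End(H)) : Prop :=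
  \sum_(j < n) Ad dot (T j) P = P.

Definition Cstar_extreme (P : 'End(H)) : set (A -> 'End(H)) :=
  [set Phi | CPP P Phi /\
    forall n (T : 'I_n -> 'End(H)) (Psi : 'I_n -> A -> 'End(H)),
      (0 < n)%N -> (forall j, CPP P (Psi j)) ->
      (forall j, invertible_op (T j)) -> Cstar_coeffs P T ->
      Phi = Cstar_sum T Psi ->
      exists S : 'I_n -> 'End(H), forall j,
        invertible_op (S j) /\ Psi j = (fun a => Ad dot (S j) (Phi a))].

Definition Cstar_hull (P : 'End(H)) (E : set (A -> 'End(H))) :
    set (A -> 'End(H)) :=
  [set Phi | exists n (T : 'I_n -> 'End(H)) (Psi : 'I_n -> A -> 'End(H)),
    [/\ (0 < n)%N, forall j, E (Psi j), Cstar_coeffs P T &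
        Phi = Cstar_sum T Psi]].

Definition bounded_by (M : R) (Phi : A -> 'End(H)) : Prop :=
  0 <= M /\ forall (a : A) (h : H),
    hnorm dot (Phi a h) <= M * cnorm a * hnorm dot h.

(* The predual of the space B(A, B(H)) of bounded linear maps is the norm
   closure, in its dual, of the linear span of the functionals
   Phi |-> <Phi(a) h, k>.  The coefficients of the linear combinations are
   absorbed in a.  Only the restriction of F to B(A, B(H)) matters. *)
Definition in_predual (F : (A -> 'End(H)) -> R[i]) : Prop :=
  forall e : R, 0 < e -> exists s : seq (A * H * H),
    forall (M : R) (Phi : A -> 'End(H)), linear Phi -> bounded_by M Phi ->
      `|F Phi - \sum_(x <- s) dot (Phi x.1.1 x.1.2) x.2| <= (e * M)%:C.

Definition predual := {F : (A -> 'End(H)) -> R[i] | in_predual F}.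

Definition predual_eval (Phi : A -> 'End(H)) :
  prod_topology (fun _ : predual => R[i]^o) := fun F => sval F Phi.

(* The weak* topology: the coarsest one making the functionals of the predual
   continuous.  It is put on all functions A -> B(H), and induces the BW
   topology on B(A, B(H)) and on its subset CP(A, B(H)). *)
Definition BW : topologicalType := initial_topology predual_eval.

Definition BW_closure_in_CP (E : set (A -> 'End(H))) : set (A -> 'End(H)) :=
  CP `&` closure (E : set BW).

End CompletelyPositive.

(* Main.v *)
From HB Require Import structures.
Require Import Defs.
From mathcomp Require Import all_boot all_order all_algebra.
From mathcomp Require Import sesquilinear complex.
From mathcomp Require Import all_classical all_reals all_analysis.
From mathcomp Require Import ring lra.
Import Order.TTheory GRing.Theory Num.Theory.
Import Num.Def.
Import numFieldNormedType.Exports.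
Local Open Scope classical_set_scope.
Local Open Scope ring_scope.
Local Open Scope complex_scope.

Set Implicit Arguments.
Unset Strict Implicit.
Unset Printing Implicit Defensive.

(** A completely positive map [Phi] is studied through the functionals
    [a |-> <Phi(a) h_j, h_i>], which form a positive kernel, i.e. a positive
    functional on matrices over [A].  The kernels agreeing with that of [Phi]
    on a finite set [s] containing [1] form a compact convex set.  An extreme
    point of it spans a finite-dimensional face of the cone of positive kernels,
    because only finitely many linear conditions were imposed (this is where
    [dim H < oo] is used); hence it is a finite sum of pure maps [Phi_k], and
    the BW closure reduces to this finite agreement.

    It remains to write a pure map [Phi_1] with [Phi_1(1) <= P] as [Ad_T o Psi]
    with [Psi] extreme and [Ad_T P = Phi_1(1)].  The map [Psi] is [Phi_1]
    transported into the support of [P] and completed there by copies of a vector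
    state of [Phi_1].  It is a compression of [Phi_1 (x) 1], so a CP map below
    [Psi] lifts to one below [Phi_1 (x) 1] (a form of Arveson's Radon-Nikodym
    theorem) and, [Phi_1] being pure, is a compression of [Phi_1 (x) B] with
    [B >= 0].  A triangular factorization [B = L^* L] turns it into
    [Ad_S o Psi], which gives the [C^*]-extremality. *)

(** Kernels replace the Stinespring space by the free [A]-module on the index set with a
    semidefinite form: nothing is completed, and a projection becomes a minimising sequence followed
    by an ultrafilter limit. Finite agreement suffices for density because [CPP] is uniformly
    bounded and a predual functional is, on bounded sets, uniformly close to a finite sum of matrix
    coefficients; agreement at [1] makes the hull condition on the coefficients exact. The
    compression of [Phi_1 (x) 1] giving [Psi] is spanned by vectors [f_i (x) e_i0] and
    [f_i0 (x) e_k]. For [1 (x) L] to preserve this subspace, [L e_i0] should be a multiple of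
    [e_i0]; a triangular factor ensures this, the square root of [B] does not. Finally [P] may be
    singular: the operator obtained is only an isometry for the seminorm of [P], and is made
    invertible by a change by [P]-null vectors, which every CP map with value [P] at [1] kills. *)

(** * C*-algebras *)

Section CStarAlgebra.
Variables (R : realType) (A : unitalCStarType R).
Implicit Types a b x y : A.

Lemma cstar0 : cstar (0 : A) = 0.
Proof. by rewrite -[X in cstar X](scale0r (0 : A)) cstarZ conjC0 scale0r. Qed.

Lemma cstar1 : cstar (1 : A) = 1.
Proof. by rewrite -[LHS]mulr1 -{2}[1](@cstarK R A) -cstarM mulr1 cstarK. Qed.

Lemma cstarN a : cstar (- a) = - cstar a.
Proof. by rewrite -scaleN1r cstarZ rmorphN1 scaleN1r. Qed.

Lemma cstarB a b : cstar (a - b) = cstar a - cstar b.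
Proof. by rewrite cstarD cstarN. Qed.

Lemma cnormZr (r : R) a : cnorm (r%:C *: a) = `|r| * cnorm a.
Proof.
apply: complexI; rewrite cnormZ rmorphM/=; congr (_ * _).
by rewrite normc_def /= expr0n addr0 sqrtr_sqr.
Qed.

Lemma cnorm0 : cnorm (0 : A) = 0.
Proof.
by rewrite -[X in cnorm X](scale0r (0 : A)) -[0 : R[i]]/(0%:C) cnormZr normr0 mul0r.
Qed.

Lemma cnormN a : cnorm (- a) = cnorm a.
Proof.
by apply: complexI; rewrite -scaleN1r cnormZ normrN1 mul1r.
Qed.

Lemma cnormBC a b : cnorm (a - b) = cnorm (b - a).
Proof. by rewrite -cnormN opprB. Qed.

Lemma cnorm_ge0 a : 0 <= cnorm a.
Proof.
have := cnormD a (- a); rewrite subrr cnorm0 cnormN -mulr2n pmulrn_lge0 //.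
Qed.

Lemma cnorm_star a : cnorm (cstar a) = cnorm a.
Proof.
have le b : cnorm b <= cnorm (cstar b).
  have [/eqP b0|b0] := boolP (cnorm b == 0); first by rewrite b0 cnorm_ge0.
  have b_gt0 : 0 < cnorm b by rewrite lt_neqAle eq_sym b0 cnorm_ge0.
  by rewrite -(ler_pM2r b_gt0) -expr2 -cnorm_cstar cnormM.
by apply/eqP; rewrite eq_le le andbT -{2}(@cstarK R A a) le.
Qed.

Lemma cnorm_small a : (forall e : R, 0 < e -> cnorm a <= e) -> a = 0.
Proof.
move=> ae; apply: cnorm_eq0; apply/eqP; rewrite eq_le cnorm_ge0 andbT.
by apply/ler_addgt0Pl => e /ae; rewrite addr0.
Qed.

(* A square root of [1 - x] is [1 - z], where [z] is the fixed point of the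
   contraction [z |-> (x + z ^+ 2) / 2]. *)
Lemma sqrt_one_minus x : cstar x = x -> cnorm x <= 2^-1 ->
  exists y : A, cstar y = y /\ y * y = 1 - x.
Proof.
move=> xs xn.
pose h : R[i] := (2^-1 : R)%:C.
have hh : h + h = 1.
  rewrite /h -rmorphD /=.
  by apply: (congr1 (real_complex R) (_ : 2^-1 + 2^-1 = 1)); field.
have hs : conjC h = h by apply: (conjc_real (2^-1 : R)).
pose z := fix z n := if n is n'.+1 then h *: (x + z n' * z n') else 0.
have zs n : cstar (z n) = z n.
  elim: n => [|n IH] /=; first exact: cstar0.
  by rewrite cstarZ cstarD cstarM xs IH hs.
(* Each [z n] is a polynomial in [x], so it commutes with whatever commutes with [x]; hence the
   iterates commute with one another, as the difference of squares below requires. *)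
have zc b : GRing.comm b x -> forall n, GRing.comm b (z n).
  move=> bx; elim=> [|n IH] /=; first exact: commr0.
  rewrite /GRing.comm -scalerAl -scalerAr; congr (_ *: _).
  by apply: commrD => //; apply: commrM.
have zz m n : GRing.comm (z m) (z n).
  by apply: (zc); apply: commr_sym; apply: (zc).
have zn n : cnorm (z n) <= 2^-1.
  elim: n => [|n IH] /=; first by rewrite cnorm0 invr_ge0.
  rewrite cnormZr ger0_norm ?invr_ge0 //.
  have := cnormD x (z n * z n); have := cnormM (z n) (z n).
  have := cnorm_ge0 (z n); nra.
(* The contraction ratio is 1/2 because [z (n + k) + z n] has norm at most 1. *)
have zk n k : cnorm (z (n + k)%N - z n) <= 2^-1 ^+ n.
  elim: n => [|n IH]; first by rewrite subr0 expr0; have := zn (0 + k)%N; lra.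
  rewrite addSn /= -scalerBr opprD addrACA subrr add0r.
  have -> : z (n + k)%N * z (n + k)%N - z n * z n
      = (z (n + k)%N - z n) * (z (n + k)%N + z n).
    by rewrite mulrDr !mulrBl (zz n (n + k)%N) addrA addrNK.
  rewrite cnormZr ger0_norm ?invr_ge0 // exprS ler_pM2l ?invr_gt0 //.
  apply: le_trans IH; have := cnormM (z (n + k)%N - z n) (z (n + k)%N + z n).
  have := cnormD (z (n + k)%N) (z n); have := zn n; have := zn (n + k)%N.
  have := cnorm_ge0 (z (n + k)%N - z n); nra.
have half_small (e : R) : 0 < e -> exists N, forall n, (N <= n)%N -> 2^-1 ^+ n < e.
  move=> e0; have := @cvg_expr R 2^-1.
  rewrite ger0_norm ?invr_ge0 // invf_lt1 ?ltr1n // => /(_ isT).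
  move=> /cvgrPdist_lt /(_ e e0) [N _ NP]; exists N => n /NP /=.
  by rewrite sub0r normrN ger0_norm // exprn_ge0 // invr_ge0.
have [//|l lP] := @cnorm_complete R A z.
  move=> e e0; have [|N NP] := half_small (e / 2); first by rewrite divr_gt0.
  exists N => m n Nm Nn.
  have := zk N (m - N)%N; have := zk N (n - N)%N; rewrite !subnKC //.
  have := NP N (leqnn N); rewrite (cnormBC (z n)).
  have := cnormD (z m - z N) (z N - z n); rewrite addrA addrNK; lra.
have ls : cstar l = l.
  apply/eqP; rewrite -subr_eq0; apply/eqP; apply: cnorm_small => e e0.
  have [|N NP] := lP (e / 2); first by rewrite divr_gt0.
  have := NP N (leqnn N).
  have := cnormD (cstar l - z N) (z N - l); rewrite addrA addrNK.
  by rewrite -{1}(zs N) -cstarB cnorm_star (cnormBC l); lra.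
have lE : l = h *: (x + l * l).
  apply/eqP; rewrite -subr_eq0; apply/eqP; apply: cnorm_small => e e0.
  have ln : cnorm l <= 1.
    have [|N NP] := lP 2^-1; first by rewrite invr_gt0.
    have := NP N (leqnn N); have := zn N.
    have := cnormD (z N) (l - z N); rewrite addrC subrK (cnormBC l); lra.
  have [|N NP] := lP (e / 2); first by rewrite divr_gt0.
  have H1 := NP N (leqnn N); have H2 := NP N.+1 (leqnSn N).
  (* Splitting the difference of squares this way avoids commuting [z N] with the limit [l]. *)
  have -> : l - h *: (x + l * l) =
      (l - z N.+1) + h *: (z N * (z N - l) + (z N - l) * l).
    rewrite /= mulrBr mulrBl addrA addrNK scalerBr -addrA; congr (l + _).
    by rewrite !scalerDr !opprD -!addrA addKr.
  apply: le_trans (cnormD _ _) _; rewrite (cnormBC l) cnormZr.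
  rewrite ger0_norm ?invr_ge0 //.
  have := cnormD (z N * (z N - l)) ((z N - l) * l).
  have := cnormM (z N) (z N - l); have := cnormM (z N - l) l.
  have := zn N; have := cnorm_ge0 (z N - l); have := cnorm_ge0 (z N).
  have := cnorm_ge0 l; nra.
exists (1 - l); split; first by rewrite cstarB cstar1 ls.
have : (h + h) *: (x + l * l) = l + l by rewrite scalerDl -!lE.
rewrite hh scale1r => /(canRL (addrK _)) ->.
rewrite mulrBl mul1r mulrBr mulr1 !opprB -addrA; congr (1 + _).
by rewrite addrCA -opprD.
Qed.

(** Stands in for the bound of [cstar a * a] by its norm: the factor 2 brings the rescaled element
    into the ball of radius 1/2, where [sqrt_one_minus] yields a square root. *)
Lemma cstar_sq_bound a : exists y : A,
  (2 * cnorm a ^+ 2)%:C *: 1 - cstar a * a = cstar y * y.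
Proof.
have [/eqP a0|a0] := boolP (cnorm a == 0).
  exists 0; rewrite a0 expr0n mulr0 scale0r (cnorm_eq0 _ a0) !mulr0.
  by rewrite subrr.
have ap : 0 < cnorm a by rewrite lt_neqAle eq_sym a0 cnorm_ge0.
set k := 2 * _ ^+ 2; have kp : 0 < k by rewrite mulr_gt0 // exprn_gt0.
have sc (r s : R) (b : A) : r%:C *: (s%:C *: b) = (r * s)%:C *: b.
  by rewrite scalerA -rmorphM.
have cc (r : R) : conjC (r%:C) = r%:C by apply: conjc_real.
have [||y [ys yy]] := @sqrt_one_minus (k^-1%:C *: (cstar a * a)).
- by rewrite cstarZ cstarM cstarK cc.
- rewrite cnormZr cnorm_cstar ger0_norm ?invr_ge0 ?(ltW kp) // /k.
  by rewrite invfM -mulrA mulVf ?mulr1 // expf_neq0.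
exists ((Num.sqrt k)%:C *: y); rewrite cstarZ cc ys -scalerAl -scalerAr sc.
rewrite -expr2 sqr_sqrtr ?(ltW kp) // yy scalerBr sc mulfV ?gt_eqF //.
by rewrite scale1r.
Qed.

End CStarAlgebra.

(** * Positive forms, limits and kernels *)

Local Close Scope complex_scope.

Section PsdForm.
Variables (C : numClosedFieldType) (V : Type).
Variables (add : V -> V -> V) (scl : C -> V -> V) (q : V -> V -> C).
Hypothesis qDl : forall x y z, q (add x y) z = q x z + q y z.
Hypothesis qDr : forall x y z, q z (add x y) = q z x + q z y.
Hypothesis qZl : forall c x y, q (scl c x) y = c * q x y.
Hypothesis qZr : forall c x y, q x (scl c y) = c^* * q x y.
Hypothesis q_ge0 : forall x, 0 <= q x x.

(** [V] is a bare type because one instance consists of finite sequences, with concatenation as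
    addition, which form no vector space. *)
Lemma psd_expand c x y :
  q (add x (scl c y)) (add x (scl c y)) =
  q x x + (c^* * q x y + c * q y x) + c * c^* * q y y.
Proof. by rewrite !qDl !qDr !qZl !qZr; ring. Qed.

(** The form is real at x + y and at x + i y, and these two conditions determine [q y x]. *)
Lemma psd_herm x y : q y x = (q x y)^*.
Proof.
have E c : c * (q x y)^* + c^* * (q y x)^* = c^* * q x y + c * q y x.
  have := q_ge0 (add x (scl c y)); rewrite psd_expand => /geC0_conj.
  rewrite !rmorphD !rmorphM /= !conjCK !(geC0_conj (q_ge0 _)).
  by rewrite [c^* * c]mulrC => /addIr /addrI.
have := E 1; rewrite conjC1 !mul1r => E1.
have := E 'i; rewrite conjCi !mulNr -!mulrN -!mulrDr => /(mulfI (neq0Ci C)) E2.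
have := congr2 +%R E1 E2.
have -> (u v : C) : u + v + (u - v) = u * 2 by ring.
have -> (u v : C) : u + v + (- u + v) = v * 2 by ring.
by move=> /(mulIf _) ->; rewrite ?pnatr_eq0.
Qed.

Lemma psd_CauchySchwarz x y : `|q x y| ^+ 2 <= q x x * q y y.
Proof.
have E c : 0 <= q x x + (c^* * q x y + c * (q x y)^*) + c * c^* * q y y.
  by rewrite -psd_herm -psd_expand.
have rN z : 0 <= z -> z^* = z :> C by move=> /geC0_conj.
have [y0|y0] := eqVneq (q y y) 0; last first.
  have y_gt0 : 0 < q y y by rewrite lt_neqAle eq_sym y0 q_ge0.
  (* The scalar that minimises the form along [y]. *)
  have := E (- (q x y / q y y)).
  rewrite rmorphN rmorphM fmorphV /= (rN _ (q_ge0 y)) => H.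
  rewrite -subr_ge0 -(pmulr_lge0 _ (_ : 0 < (q y y)^-1)) ?invr_gt0 //.
  by apply: le_trans H _; rewrite le_eqVlt; apply/orP; left; apply/eqP;
    rewrite normCK; field.
rewrite y0 mulr0.
have x1 : 0 < q x x + 1 by rewrite ltr_wpDl.
(* When [q y y = 0] the form is affine in [c]; unless [q x y = 0], this choice gives it the negative
   value q x x - 2 (q x x + 1). *)
have := E (- (q x x + 1) * q x y / `|q x y| ^+ 2).
have [->|xy0] := eqVneq (q x y) 0; first by rewrite normr0 expr0n.
have n0 : `|q x y| ^+ 2 != 0 by rewrite expf_neq0 // normr_eq0.
rewrite y0 mulr0 addr0 !rmorphM fmorphV /= rmorphN /= (rN _ (ltW x1)).
rewrite (rN (`|q x y| ^+ 2)) ?exprn_ge0 //.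
have -> : - (q x x + 1) * (q x y)^* / `|q x y| ^+ 2 * q x y +
   - (q x x + 1) * q x y / `|q x y| ^+ 2 * (q x y)^* = - ((q x x + 1) + (q x x + 1)).
  by rewrite normCK; field; rewrite conjC_eq0 xy0.
have -> : q x x - (q x x + 1 + (q x x + 1)) = - (1 + (q x x + 1)) by ring.
rewrite oppr_ge0 => H.
by have := lt_le_trans (ltr_wpDl ler01 x1) H; rewrite ltxx.
Qed.

(** Moving [u] by -(q u z / q z z) z lowers the form by |q u z|^2 / q z z, which near-minimality
    bounds by [e]. This is a quantitative orthogonality relation. *)
Lemma psd_min e u z : 0 <= e ->
  (forall c, q u u - e <= q (add u (scl c z)) (add u (scl c z))) ->
  `|q u z| ^+ 2 <= e * q z z.
Proof.
move=> e0 umin; have [z0|z0] := eqVneq (q z z) 0.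
  by have := psd_CauchySchwarz u z; rewrite z0 !mulr0.
have z_gt0 : 0 < q z z by rewrite lt_neqAle eq_sym z0 q_ge0.
have := umin (- (q u z / q z z)); rewrite psd_expand (psd_herm u z).
rewrite rmorphN rmorphM fmorphV /= (geC0_conj (q_ge0 z)) -subr_ge0 => H.
rewrite -subr_ge0 -(pmulr_lge0 _ (_ : 0 < (q z z)^-1)) ?invr_gt0 //.
by apply: le_trans H _; rewrite le_eqVlt; apply/orP; left; apply/eqP;
  rewrite normCK; field.
Qed.

End PsdForm.

Local Open Scope complex_scope.

(** * Complex limits along filters and ultrafilters *)

Section FilterLimits.
Variables (R : realType) (T : Type) (F : set_system T).
Context {FF : ProperFilter F}.
Local Notation C := R[i].
Definition clim (f : T -> C) (l : C) := f @ F --> (l : C^o).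
Lemma clim_cst c : clim (fun=> c) c.
Proof. exact: (@cvg_cst C^o). Qed.
Lemma climD f g a b : clim f a -> clim g b -> clim (fun t => f t + g t) (a + b).
Proof. exact: (@cvgD _ C^o). Qed.
Lemma climB f g a b : clim f a -> clim g b -> clim (fun t => f t - g t) (a - b).
Proof. exact: (@cvgB _ C^o). Qed.
Lemma climZ f c a : clim f a -> clim (fun t => c * f t) (c * a).
Proof. exact: (@cvgZr _ C^o). Qed.
Lemma clim_unique f a b : clim f a -> clim f b -> a = b.
Proof. by move=> fa fb; exact: (@cvg_unique C^o (@norm_hausdorff _ C^o) (f @ F) _ a b fa fb). Qed.
Lemma climP f l : clim f l <-> forall e : R, 0 < e -> F [set t | `|l - f t| < e%:C].
Proof.
split=> [/(@cvgrPdist_lt _ C^o) fl e e0|fl].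
  by apply: fl; rewrite (ltcR 0).
apply/(@cvgrPdist_lt _ C^o) => e e0.
have [r re] : exists r : R, e = r%:C by apply/complex_realP; rewrite realE ltW.
by move: e0; rewrite re (ltcR 0); exact: fl.
Qed.
Lemma clim_sum (I : Type) (s : seq I) (f : I -> T -> C) (l : I -> C) :
  (forall i, clim (f i) (l i)) -> clim (fun t => \sum_(i <- s) f i t) (\sum_(i <- s) l i).
Proof.
move=> fl; elim: s => [|i s IH].
  rewrite big_nil; under eq_fun do rewrite big_nil; exact: clim_cst.
by rewrite big_cons; under eq_fun do rewrite big_cons; exact: climD.
Qed.
(** In the order of [R[i]], comparable elements differ by a real number, so the lower bounds also
    force the values of [f], and with them the limit, to be real. *)
Lemma clim_ge0 f l : clim f l -> (forall e : R, 0 < e -> F [set t | - e%:C <= f t]) -> 0 <= l.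
Proof.
move=> /climP fl f0; rewrite lecE /=.
have P (e : R) : 0 < e -> `|complex.Im l| <= e /\ - e <= complex.Re l.
  move=> e0; have e2 : 0 < e / 2 by rewrite divr_gt0.
  have [t [/= ht]] := filter_ex (filterI (f0 _ e2) (fl _ e2)).
  move: ht; rewrite lecE /= oppr0 => /andP[/eqP i0 r0] /ltW h.
  have hr : `|complex.Re (l - f t)| <= e / 2.
    by rewrite -lecR; apply: le_trans (normc_ge_Re _) h.
  have hi : `|complex.Im (l - f t)| <= e / 2.
    rewrite -lecR; apply: le_trans h.
    have := normc_ge_Re ((l - f t) * 'i%C); rewrite ReiNIm normrN.
    by rewrite normrM [`|'i%C|]normc_def /= expr0n expr1n add0r sqrtr1 mulr1.
  clear h; move: i0 r0 hr hi; case: (f t) => u' v'; case: (l) => u v /= ->.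
  by rewrite subr0 ler_norml => ? /andP[? ?] ?; split; lra.
apply/andP; split.
  by rewrite -normr_le0; apply/ler_addgt0Pl => e /P[]; rewrite addr0.
by apply/ler_addgt0Pl => e /P[]; lra.
Qed.
End FilterLimits.

Section UltraLimits.
Variables (R : realType) (T : Type) (F : set_system T).
Hypothesis FU : UltraFilter F.

Lemma ultra_bounded_cvg (f : T -> R) (M : R) :
  F [set t | `|f t| <= M] -> exists l : R, f @ F --> l.
Proof.
move=> FM.
have := @segment_compact R (- M) M; rewrite compact_ultra => /(_ (f @ F)).
have fU : UltraFilter (f @ F).
  split=> [|G GF]; first exact: fmap_proper_filter.
  move=> H; apply/seteqP; split=> [B GB|]; last exact: H.
  have [//|] := in_ultra_setVsetC (f @^-1` B) FU.
  by rewrite preimage_setC => /H /(filterI GB); rewrite setICr => /filter_not_empty.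
case=> [|l [_ fl]]; last by exists l.
change (F (f @^-1` `[- M, M]%classic)); apply: filterS FM => t /=.
by rewrite in_itv /= ler_norml.
Qed.

Lemma ultra_bounded_cvgC (f : T -> R[i]) (M : R) :
  F [set t | `|f t| <= M%:C] -> exists l : R[i], clim F f l.
Proof.
move=> FM.
have [|a fa] := @ultra_bounded_cvg (fun t => complex.Re (f t)) M.
  apply: filterS FM => t /=; rewrite -lecR; apply: le_trans.
  exact: normc_ge_Re.
have [|b fb] := @ultra_bounded_cvg (fun t => complex.Im (f t)) M.
  apply: filterS FM => t /=; rewrite -lecR; apply: le_trans.
  have := normc_ge_Re (f t * 'i%C); rewrite ReiNIm normrN.
  by rewrite normrM [`|'i%C|]normc_def /= expr0n expr1n add0r sqrtr1 mulr1.
exists (a +i* b); apply/(@cvgrPdist_lt _ R[i]^o) => e e0.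
have [r re] : exists r : R, e = r%:C by apply/complex_realP; rewrite realE ltW.
move: e0; rewrite re (ltcR 0) => r0.
have r2 : 0 < r / 2 by rewrite divr_gt0.
move/cvgrPdist_lt: fa => /(_ _ r2) fa; move/cvgrPdist_lt: fb => /(_ _ r2) fb.
apply: filterS2 fa fb => t /= ha hb.
rewrite (complexE (_ - f t)); apply: le_lt_trans (ler_normD _ _) _.
rewrite normrM [`|'i%C|]normc_def /= expr0n expr1n add0r sqrtr1 mul1r.
have nR (x : R) : `|x%:C| = `|x|%:C by rewrite normc_def /= expr0n addr0 sqrtr_sqr.
rewrite !nR -rmorphD /= ltcR.
case: (f t) ha hb => u v /= ha hb; lra.
Qed.

End UltraLimits.

(** * Positive kernels over a C*-algebra *)

Section Kernels.
Variables (R : realType) (A : unitalCStarType R).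
Local Notation C := R[i].

Definition akernel (I : Type) := I -> I -> A -> C.

Section OneIndexType.
Variable I : Type.
Implicit Types (phi psi : akernel I) (s t : seq (I * A)) (a b : A).

(* The sesquilinear form induced by [phi] on the free [A]-module on [I]. *)
Definition kform phi s t : C :=
  \sum_(p <- t) \sum_(r <- s) phi p.1 r.1 (cstar p.2 * r.2).

Definition poskern phi : Prop :=
  (forall i j, scalar (phi i j)) /\ forall s, 0 <= kform phi s s.

Definition kact a s : seq (I * A) := [seq (p.1, a * p.2) | p <- s].
Definition kscl (c : C) s : seq (I * A) := [seq (p.1, c *: p.2) | p <- s].

Definition aksub phi psi : akernel I := fun i j a => phi i j a - psi i j a.
Definition akadd phi psi : akernel I := fun i j a => phi i j a + psi i j a.
Definition akscale (c : C) phi : akernel I := fun i j a => c * phi i j a.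

Lemma kform1 phi i j a b :
  kform phi [:: (j, a)] [:: (i, b)] = phi i j (cstar b * a).
Proof. by rewrite /kform !big_seq1. Qed.

Lemma kform_sub phi psi s t : kform (aksub phi psi) s t = kform phi s t - kform psi s t.
Proof.
rewrite /kform -sumrB; apply: eq_bigr => p _; rewrite -sumrB.
exact: eq_bigr.
Qed.

Lemma kform_add phi psi s t : kform (akadd phi psi) s t = kform phi s t + kform psi s t.
Proof.
rewrite /kform -big_split; apply: eq_bigr => p _; rewrite -big_split.
exact: eq_bigr.
Qed.

Lemma kform_scale c phi s t : kform (akscale c phi) s t = c * kform phi s t.
Proof.
rewrite /kform big_distrr; apply: eq_bigr => p _; rewrite big_distrr.
exact: eq_bigr.
Qed.

Lemma kform_catl phi s1 s2 t : kform phi (s1 ++ s2) t = kform phi s1 t + kform phi s2 t.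
Proof. by rewrite /kform -big_split; apply: eq_bigr => p _; rewrite big_cat. Qed.

Lemma kform_catr phi s t1 t2 : kform phi s (t1 ++ t2) = kform phi s t1 + kform phi s t2.
Proof. by rewrite /kform big_cat. Qed.

(** Left multiplications form a *-representation: this is the Stinespring representation before
    completion. *)
Lemma kform_act phi a s t : kform phi (kact a s) t = kform phi s (kact (cstar a) t).
Proof.
rewrite /kform big_map; apply: eq_bigr => p _; rewrite big_map.
by apply: eq_bigr => r _; rewrite cstarM cstarK mulrA.
Qed.

Lemma kform_actr phi a s t : kform phi s (kact a t) = kform phi (kact (cstar a) s) t.
Proof. by rewrite kform_act cstarK. Qed.

Lemma kactM a b s : kact a (kact b s) = kact (a * b) s.
Proof. by rewrite /kact -map_comp; apply: eq_map => -[i x] /=; rewrite mulrA. Qed.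

Section Linear.
Variable phi : akernel I.
Hypothesis phiL : forall i j, scalar (phi i j).

Lemma kern0 i j : phi i j 0 = 0.
Proof. by have := phiL i j (-1) 0 0; rewrite scaler0 addr0 mulN1r addNr. Qed.

Lemma kernZ c i j a : phi i j (c *: a) = c * phi i j a.
Proof. by have := phiL i j c a 0; rewrite !addr0 kern0 addr0. Qed.

Lemma kernD i j a b : phi i j (a + b) = phi i j a + phi i j b.
Proof. by have := phiL i j 1 a b; rewrite scale1r mul1r. Qed.

Lemma kernB i j a b : phi i j (a - b) = phi i j a - phi i j b.
Proof. by rewrite kernD -scaleN1r kernZ mulN1r. Qed.

Lemma kform_scll c s t : kform phi (kscl c s) t = c * kform phi s t.
Proof.
rewrite /kform mulr_sumr; apply: eq_bigr => p _; rewrite big_map mulr_sumr.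
by apply: eq_bigr => r _; rewrite -scalerAr kernZ.
Qed.

Lemma kform_sclr c s t : kform phi s (kscl c t) = conjC c * kform phi s t.
Proof.
rewrite /kform mulr_sumr big_map; apply: eq_bigr => p _; rewrite mulr_sumr.
by apply: eq_bigr => r _; rewrite cstarZ -scalerAl kernZ.
Qed.

Lemma kform_actB (c : C) b s t :
  kform phi (kact (c *: 1 - b) s) t = c * kform phi s t - kform phi (kact b s) t.
Proof.
rewrite /kform mulr_sumr -sumrB; apply: eq_bigr => p _.
rewrite !big_map mulr_sumr -sumrB; apply: eq_bigr => r _ /=.
by rewrite mulrBl mulrBr -scalerAl mul1r -scalerAr kernB kernZ.
Qed.

End Linear.

Section Positive.
Variable phi : akernel I.
Hypothesis phiP : poskern phi.
Let phiL := phiP.1.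
Let phi0 := phiP.2.

Lemma kform_herm s t : kform phi t s = conjC (kform phi s t).
Proof.
exact: (psd_herm (kform_catl phi) (fun x y z => kform_catr phi z x y)
  (kform_scll phiL) (fun c x y => kform_sclr phiL c x y) phi0).
Qed.

Lemma kform_CS s t : `|kform phi s t| ^+ 2 <= kform phi s s * kform phi t t.
Proof.
exact: (psd_CauchySchwarz (kform_catl phi) (fun x y z => kform_catr phi z x y)
  (kform_scll phiL) (fun c x y => kform_sclr phiL c x y) phi0).
Qed.

Lemma kform_min (e : C) s t : 0 <= e ->
  (forall c, kform phi s s - e <= kform phi (s ++ kscl c t) (s ++ kscl c t)) ->
  `|kform phi s t| ^+ 2 <= e * kform phi t t.
Proof.
exact: (psd_min (kform_catl phi) (fun x y z => kform_catr phi z x y)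
  (kform_scll phiL) (fun c x y => kform_sclr phiL c x y) phi0).
Qed.

(** By [cstar_sq_bound] the difference of the two sides is the form at [kact y s]; the
    representation is therefore bounded. *)
Lemma kform_act_le a s :
  kform phi (kact a s) (kact a s) <= (2 * cnorm a ^+ 2)%:C * kform phi s s.
Proof.
have [y yE] := cstar_sq_bound a.
by rewrite -subr_ge0 kform_actr kactM -kform_actB // yE -kactM -kform_actr.
Qed.

Lemma kern_diag_ge0 i : 0 <= phi i i 1.
Proof. by have := phi0 [:: (i, 1)]; rewrite kform1 cstar1 mulr1. Qed.

(** Cauchy-Schwarz between [a] at [j] and [1] at [i]. Control by the diagonal values at [1] is the
    source of compactness and of the norm bound on [CPP]. *)
Lemma kern_bound i j a :
  `|phi i j a| ^+ 2 <= (2 * cnorm a ^+ 2)%:C * (phi i i 1 * phi j j 1).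
Proof.
have := kform_CS [:: (j, a)] [:: (i, 1)].
rewrite !kform1 cstar1 !mul1r => /le_trans; apply.
rewrite [phi i i 1 * _]mulrC mulrA ler_wpM2r ?kern_diag_ge0 //.
have := kform_act_le a [:: (j, 1)].
by rewrite /kact /= !kform1 !mulr1 cstar1.
Qed.

Lemma kern_null i j a : phi i i 1 = 0 \/ phi j j 1 = 0 -> phi i j a = 0.
Proof.
move=> ij0; have := kern_bound i j a.
have -> : phi i i 1 * phi j j 1 = 0 by case: ij0 => ->; rewrite ?mul0r ?mulr0.
rewrite mulr0 => H; apply/eqP; rewrite -normr_eq0 -sqrf_eq0.
by rewrite eq_le H exprn_ge0.
Qed.

End Positive.
Lemma poskern_add phi psi : poskern phi -> poskern psi -> poskern (akadd phi psi).
Proof.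
move=> [pl p0] [ql q0]; split=> [i j c a b|s].
  by rewrite /akadd pl ql mulrDr addrACA.
by rewrite kform_add addr_ge0.
Qed.

Lemma poskern_scale c phi : 0 <= c -> poskern phi -> poskern (akscale c phi).
Proof.
move=> c0 [pl p0]; split=> [i j d a b|s].
  by rewrite /akscale pl mulrDr mulrCA.
by rewrite kform_scale mulr_ge0.
Qed.

Lemma poskern0 : poskern (fun _ _ _ => 0 : C).
Proof.
split=> [i j c a b|s]; first by rewrite mulr0 addr0.
by rewrite /kform big1 // => p _; rewrite big1.
Qed.

Lemma poskern_sum n (phi : 'I_n -> akernel I) : (forall k, poskern (phi k)) ->
  poskern (fun i j a => \sum_k phi k i j a).
Proof.
move=> pP; split=> [i j c a b|s].
  by rewrite mulr_sumr -big_split; apply: eq_bigr => k _; rewrite (pP k).1.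
rewrite /kform (eq_bigr (fun p => \sum_k \sum_(r <- s) phi k p.1 r.1 (cstar p.2 * r.2))).
  by rewrite exchange_big sumr_ge0 // => k _; exact: (pP k).2.
by move=> p _; rewrite exchange_big.
Qed.

End OneIndexType.

Lemma kform_pull I J (h : J -> I) (phi : akernel I) (s t : seq (J * A)) :
  kform (fun i j => phi (h i) (h j)) s t =
  kform phi [seq (h p.1, p.2) | p <- s] [seq (h p.1, p.2) | p <- t].
Proof.
by rewrite /kform big_map; apply: eq_bigr => p _; rewrite big_map.
Qed.

Lemma poskern_pull I J (h : J -> I) (phi : akernel I) :
  poskern phi -> poskern (fun i j => phi (h i) (h j)).
Proof.
by move=> [pl p0]; split=> [i j|s]; [exact: pl | rewrite kform_pull; exact: p0].
Qed.

End Kernels.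

(** * Lifting of dominated kernels *)

Section Lifting.
Variables (R : realType) (A : unitalCStarType R).
Local Notation C := R[i].
Variables (I0 I : Type) (j : I0 -> I).
Variables (omega : akernel A I) (theta : akernel A I0).
Hypothesis j_inj : injective j.
Hypothesis omegaP : poskern omega.
Hypothesis thetaP : poskern theta.
Hypothesis theta_le : poskern (aksub (fun a b => omega (j a) (j b)) theta).
Implicit Types (X : seq (I * A)) (Y : nat -> seq (I0 * A)) (z : seq (I0 * A)).

Let J z : seq (I * A) := [seq (j p.1, p.2) | p <- z].
Let q := kform omega.
Let qt := kform theta.
Let qge0 s : 0 <= q s s := omegaP.2 s.
Let qtge0 s : 0 <= qt s s := thetaP.2 s.

Let qt_le z : qt z z <= q (J z) (J z).
Proof. by have := theta_le.2 z; rewrite kform_sub kform_pull subr_ge0. Qed.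

Let Jact a z : J (kact a z) = kact a (J z).
Proof. by rewrite /J /kact -!map_comp. Qed.

Let Jcat z1 z2 : J (z1 ++ z2) = J z1 ++ J z2.
Proof. exact: map_cat. Qed.

(* [Y n] approximates the orthogonal projection of [X] onto the closure of the
   range of [J]. *)
Let approx X Y := forall e : R, 0 < e -> exists N, forall n, (N <= n)%N -> forall z,
  `|q X (J z) - q (J (Y n)) (J z)| ^+ 2 <= e%:C * q (J z) (J z).

(** Minimise the form at [D z], the difference of [X] and [J z]; [kform_min] converts
    near-minimality into near-orthogonality to the range of [J]. *)
Let approx_ex X : exists Y, approx X Y.
Proof.
pose D z := X ++ kscl (-1) (J z).
pose S := [set complex.Re (q (D z) (D z)) | z in setT].
have ReE s : (complex.Re (q s s))%:C = q s s by apply: RRe_real; exact: ger0_real.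
have Sinf : has_inf S.
  split; first by exists (complex.Re (q (D [::]) (D [::]))); exists [::].
  by exists 0 => _ [z _ <-]; rewrite -(lecR 0) ReE.
have /choice[Y YP] n : exists z, complex.Re (q (D z) (D z)) < inf S + n.+1%:R^-1.
  have [|_ [z _ <-] zP] := inf_adherent (_ : 0 < n.+1%:R^-1 :> R) Sinf; last by exists z.
  by rewrite invr_gt0 ltr0n.
exists Y => e e0.
have [N NP] : exists N, forall n, (N <= n)%N -> n.+1%:R^-1 <= e.
  have [N _ NP] := near_infty_natSinv_lt (PosNum e0).
  by exists N => n /NP /ltW.
exists N => n /NP ne z.
have -> : q X (J z) - q (J (Y n)) (J z) = q (D (Y n)) (J z).
  by rewrite /q kform_catl kform_scll ?mulN1r //; exact: omegaP.1.
apply: kform_min => //.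
  by rewrite (lecR 0) ltW.
move=> c.
have -> : D (Y n) ++ kscl c (J z) = D (Y n ++ kscl (- c) z).
  rewrite /D Jcat -catA; congr (_ ++ _); rewrite /kscl map_cat; congr (_ ++ _).
  by rewrite /J -!map_comp; apply: eq_map => p /=; rewrite scalerA mulN1r opprK.
rewrite -!/(q _ _) -ReE -[q (D (Y n ++ _)) _]ReE -rmorphB lecR.
have := YP n; set d := complex.Re _; move=> dn.
rewrite lerBlDr; apply: le_trans (ltW dn) _; apply: lerD => //.
by apply: (ge_inf Sinf.2); exists (Y n ++ kscl (- c) z).
Qed.

Let normD_sq (a b : C) : `|a + b| ^+ 2 <= 2 * (`|a| ^+ 2 + `|b| ^+ 2).
Proof.
apply: le_trans (_ : (`|a| + `|b|) ^+ 2 <= _).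
  by rewrite lerXn2r ?nnegrE ?addr_ge0 // ler_normD.
rewrite -subr_ge0.
have -> : 2 * (`|a| ^+ 2 + `|b| ^+ 2) - (`|a| + `|b|) ^+ 2 = (`|a| - `|b|) ^+ 2 by ring.
by rewrite real_exprn_even_ge0 // rpredB ?normr_real.
Qed.

Let approx_nil : approx [::] (fun=> [::]).
Proof.
move=> e e0; exists 0 => n _ z; rewrite subrr normr0 expr0n.
by rewrite mulr_ge0 // (lecR 0) ltW.
Qed.

Let approx_cat X Y X' Y' : approx X Y -> approx X' Y' ->
  approx (X ++ X') (fun n => Y n ++ Y' n).
Proof.
move=> aX aX' e e0; have e4 : 0 < e / 4 by rewrite divr_gt0.
have [N NP] := aX _ e4; have [N' NP'] := aX' _ e4.
exists (maxn N N') => n; rewrite geq_max => /andP[/NP h /NP' h'] z.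
rewrite Jcat /q !kform_catl opprD addrACA; apply: le_trans (normD_sq _ _) _.
have -> : e%:C * kform omega (J z) (J z) =
    2 * ((e / 4)%:C * q (J z) (J z) + (e / 4)%:C * q (J z) (J z)).
  rewrite -mulrDl mulrA -rmorphD /=; congr (_ * _).
  have -> : (2 : C) = (2 : R)%:C by rewrite rmorph_nat.
  by rewrite -rmorphM; congr (_%:C); field.
by rewrite ler_pM2l ?ltr0n // lerD.
Qed.

(** The projection is a module map: the range of [J] is stable under [A], so [a] can be moved to the
    other argument at the cost of the factor [k]. *)
Let approx_act a X Y : approx X Y -> approx (kact a X) (fun n => kact a (Y n)).
Proof.
move=> aX e e0; set k := 2 * cnorm (cstar a) ^+ 2 + 1.
have k0 : 0 < k by rewrite ltr_wpDl // mulr_ge0 // sqr_ge0.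
have [|N NP] := aX (e / k); first by rewrite divr_gt0.
exists N => n /NP h z.
rewrite Jact /q !kform_act -Jact; apply: le_trans (h _) _.
rewrite Jact; apply: le_trans (_ : (e / k)%:C * (k%:C * q (J z) (J z)) <= _).
  apply: ler_wpM2l; first by rewrite (lecR 0) divr_ge0 // ltW.
  apply: le_trans (kform_act_le omegaP _ _) _.
  by rewrite ler_wpM2r ?qge0 // lecR lerDl.
by rewrite mulrA -rmorphM mulfVK ?gt_eqF.
Qed.

(** A projection does not increase length, and [qt] is below [q] on the range of [J]. *)
Let approx_bound X Y : approx X Y -> forall e : R, 0 < e -> exists N, forall n,
  (N <= n)%N -> qt (Y n) (Y n) <= q X X + e%:C.
Proof.
move=> aX e e0.
have ReE s : (complex.Re (q s s))%:C = q s s by apply: RRe_real; exact: ger0_real.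
set x := complex.Re (q X X); have x0 : 0 <= x by rewrite -(lecR 0) ReE.
(* With t = q y y and v the real part of q X y - q y y, positivity at X - y reads t <= x - 2 v,
   while |v| <= d (1 + t) / 2; the two bounds on [d] then give t <= x + e. *)
pose d := Num.min (1 / 2) (e / (2 * x + 2)).
have d0 : 0 < d by rewrite lt_min !divr_gt0 // ltr_wpDl // mulr_ge0.
have d1 : d <= 1 / 2 by rewrite ge_min lexx.
have d2 : d * (2 * x + 2) <= e.
  by rewrite -ler_pdivlMr ?ltr_wpDl ?mulr_ge0 // ge_min lexx orbT.
have [|N NP] := aX (d ^+ 2); first by rewrite exprn_gt0.
exists N => n /NP /(_ (Y n)); set y := J (Y n) => h.
apply: le_trans (qt_le _) _; rewrite -/y -ReE -[q X X]ReE -rmorphD lecR -/x.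
set t := complex.Re (q y y); have t0 : 0 <= t by rewrite -(lecR 0) ReE.
set v := complex.Re (q X y - q y y).
have v2 : v ^+ 2 <= d ^+ 2 * t.
  have tE : t%:C = q y y by exact: ReE.
  rewrite -lecR [leRHS]rmorphM /= tE; apply: le_trans h.
  have := normc_ge_Re (q X y - q y y); rewrite -/v => nv.
  rewrite -real_normK ?num_real // rmorphXn /= lerXn2r // nnegrE //.
  by rewrite (lecR 0).
have E : 0 <= x - t - 2 * v.
  have := qge0 (X ++ kscl (-1) y); rewrite /q kform_catl !kform_catr.
  have L := omegaP.1; rewrite !kform_scll // !kform_sclr // -!/(q _ _).
  have -> : q y X = (q X y)^*%C := kform_herm omegaP X y.
  rewrite rmorphN1 /t /v /x.
  case: (q X X) (q X y) (q y y) => x1 x2 [v1 v2'] [t1 t2].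
  by rewrite lecE /= => /andP[_] /=; lra.
have : - v <= d * (1 + t) / 2.
  apply: le_trans (ler_norm _) _; rewrite normrN.
  rewrite -(ler_pXn2r (_ : (0 < 2)%N)) ?nnegrE ?normr_ge0 //; last first.
    by rewrite divr_ge0 // mulr_ge0 ?(ltW d0) // addr_ge0.
  rewrite real_normK ?num_real //; apply: le_trans v2 _.
  rewrite !exprMn -mulrA ler_pM2l ?exprn_gt0 //.
  have := sqr_ge0 (1 - t); rewrite exprVn; lra.
nra.
Qed.

(** [theta] is a form on the submodule spanned by the range of [j]; composing it with the projection
    onto that submodule gives [theta'], still below [omega] since projections contract. Its values
    are ultrafilter limits along the approximating sequences. *)
Theorem kernel_lifting : exists theta' : akernel A I,
  [/\ poskern theta', poskern (aksub omega theta') &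
      forall a b x, theta' (j a) (j b) x = theta a b x].
Proof.
have [U [UU Uoo]] := ultraFilterLemma eventually_filter.
have UP : ProperFilter U := @ultra_proper _ _ UU.
have ev (B : set nat) : (exists N, forall n, (N <= n)%N -> B n) -> U B.
  by move=> [N NB]; apply: Uoo; exists N => // n /NB.
(* At an index [j a] the constant sequence is taken, so that [theta'] extends [theta] exactly. *)
have /choice[y yP] i : exists Y, approx [:: (i, 1)] Y /\
    (forall a, i = j a -> forall n, Y n = [:: (a, 1)]).
  have [[a ->]|na] := pselect (exists a, i = j a).
    exists (fun=> [:: (a, 1)]); split=> [e e0|b /j_inj -> //].
    exists 0 => n _ z; rewrite /J /= subrr normr0 expr0n.
    by rewrite mulr_ge0 ?qge0 // (lecR 0) ltW.
  have [Y YP] := approx_ex [:: (i, 1)]; exists Y; split=> // a ia.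
  by case: na; exists a.
have lim_ex X Y X' Y' : approx X Y -> approx X' Y' ->
    exists l, clim U (fun n => qt (Y n) (Y' n)) l.
  move=> /approx_bound /(_ 1 ltr01) [N NP] /approx_bound /(_ 1 ltr01) [N' NP'].
  have ReE s : (complex.Re (q s s))%:C = q s s by apply: RRe_real; exact: ger0_real.
  pose M := Num.sqrt ((complex.Re (q X X) + 1) * (complex.Re (q X' X') + 1)).
  apply: (@ultra_bounded_cvgC R _ U UU _ M); apply: ev; exists (maxn N N') => n.
  rewrite geq_max => /andP[/NP h /NP' h'] /=.
  have M0 : 0 <= (complex.Re (q X X) + 1) * (complex.Re (q X' X') + 1).
    by rewrite mulr_ge0 // addr_ge0 // -(lecR 0) ReE.
  rewrite -(ler_pXn2r (_ : (0 < 2)%N)) ?nnegrE ?normr_ge0 ?(lecR 0) ?sqrtr_ge0 //.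
  apply: le_trans (kform_CS thetaP _ _) _.
  rewrite -rmorphXn /= sqr_sqrtr // rmorphM !rmorphD /= !ReE.
  by apply: ler_pM => //; exact: qtge0.
have /choice[th0 th0P] (t : I * I * A) : exists l,
    clim U (fun n => qt (kact t.2 (y t.1.2 n)) (y t.1.1 n)) l.
  by apply: lim_ex; [apply: approx_act; exact: (yP _).1 | exact: (yP _).1].
pose th i k x := th0 (i, k, x).
have thP i k x : clim U (fun n => qt (kact x (y k n)) (y i n)) (th i k x).
  exact: (th0P (i, k, x)).
pose Y s n := flatten [seq kact p.2 (y p.1 n) | p <- s].
have YP s : approx s (Y s).
  elim: s => [|[i x] s IH]; first exact: approx_nil.
  have := approx_cat (approx_act x (yP i).1) IH.
  by rewrite /kact /= mulr1.
have qYl s t n : qt (Y s n) t = \sum_(r <- s) qt (kact r.2 (y r.1 n)) t.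
  elim: s => [|r s IH]; first by rewrite /qt /kform big_nil big1 // => p; rewrite big_nil.
  by rewrite big_cons -IH /qt -kform_catl.
have qYr s t n : qt s (Y t n) = \sum_(p <- t) qt s (kact p.2 (y p.1 n)).
  elim: t => [|p t IH]; first by rewrite /qt /kform !big_nil.
  by rewrite big_cons -IH /qt -kform_catr.
have formP s t : clim U (fun n => qt (Y s n) (Y t n)) (kform th s t).
  under eq_fun => n do rewrite qYr.
  apply: clim_sum => p; under eq_fun => n do rewrite qYl.
  apply: clim_sum => r; under eq_fun => n do rewrite /qt kform_actr kactM.
  exact: thP.
have thL i k : scalar (th i k).
  move=> c a b; apply: (clim_unique (thP i k (c *: a + b))).
  have := climD (FF := UP) (climZ (FF := UP) (c := c) (thP i k a)) (thP i k b).
  congr clim; apply/funext => n; rewrite /qt /kform mulr_sumr -big_split.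
  apply: eq_bigr => p _; rewrite !big_map mulr_sumr -big_split.
  by apply: eq_bigr => r _ /=; rewrite mulrDl mulrDr -scalerAl -scalerAr thetaP.1.
exists th; split.
- split=> // s.
  have /(clim_ge0 (FF := UP)) := formP s s; apply => e e0.
  apply: ev; exists 0 => n _ /=; apply: le_trans (qtge0 _).
  by rewrite oppr_le0 (lecR 0) ltW.
- split=> [i k c a b|s].
    by rewrite /aksub omegaP.1 thL mulrBr opprD addrACA.
  rewrite kform_sub.
  have := climB (FF := UP) (clim_cst (FF := UP) (c := kform omega s s)) (formP s s).
  move=> /(clim_ge0 (FF := UP)); apply => e e0; apply: ev.
  have [N NP] := approx_bound (YP s) e0; exists N => n /NP /=.
  by rewrite lerBrDl lerBlDr.
- move=> a b x; apply: (clim_unique (thP _ _ _)).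
  have yJ c n : y (j c) n = [:: (c, 1)] by apply: (yP (j c)).2.
  under eq_fun => n do rewrite !yJ.
  by rewrite /qt /kact /= kform1 cstar1 mul1r mulr1; exact: clim_cst.
Qed.
End Lifting.

(** * Extreme points *)

Section ExtremeKernels.
Variables (R : realType) (A : unitalCStarType R) (I : Type).
Local Notation C := R[i].
Local Notation kern := (akernel A I).
Implicit Types (K F : set kern) (phi psi : kern).

(* Closedness for pointwise convergence, tested on ultrafilters. *)
Definition ultraclosed K := forall U : set_system kern, UltraFilter U -> U K ->
  forall phi, (forall i j a, clim U (fun psi => psi i j a) (phi i j a)) -> K phi.

Definition ptwise_bounded K := forall i j a, exists M : R,
  forall psi, K psi -> `|psi i j a| <= M%:C.

Definition kface K F := [/\ F `<=` K, F !=set0, ultraclosed F &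
  forall phi psi1 psi2, F phi -> K psi1 -> K psi2 ->
    (forall i j a, psi1 i j a + psi2 i j a = 2 * phi i j a) -> F psi1 /\ F psi2].

Lemma ptwise_bounded_lim K (U : set_system kern) : ptwise_bounded K ->
  UltraFilter U -> U K ->
  exists phi, forall i j a, clim U (fun psi => psi i j a) (phi i j a).
Proof.
move=> bK UU UK.
have /choice[f fP] (t : I * I * A) : exists l, clim U (fun psi => psi t.1.1 t.1.2 t.2) l.
  have [M MP] := bK t.1.1 t.1.2 t.2; apply: (ultra_bounded_cvgC UU (M := M)).
  by apply: filterS UK => psi; exact: MP.
by exists (fun i j a => f (i, j, a)) => i j a; exact: (fP (i, j, a)).
Qed.

Lemma clim_Re_le (T : Type) (U : set_system T) (FU : ProperFilter U) (f : T -> C) l c (M : R) :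
  clim U f l -> U [set t | complex.Re (c * f t) <= M] -> complex.Re (c * l) <= M.
Proof.
move=> fl fM;
have := climB (FF := FU) (clim_cst (FF := FU) (c := M%:C))
  (climZ (FF := FU) (c := c) fl).
move=> /climP gl; apply/ler_addgt0Pr => e e0.
have [t [/= tM]] := filter_ex (filterI fM (gl _ e0)).
move=> /ltW /(le_trans (normc_ge_Re _)); rewrite lecR ler_norml => /andP[+ _].
by rewrite !raddfB /=; lra.
Qed.

(** These real functionals separate kernels, so shrinking faces to their maximisers is what forces a
    minimal face to be a point. *)
Lemma kface_max K F c i j a : ptwise_bounded K -> kface K F ->
  kface K [set psi | F psi /\
    forall chi, F chi -> complex.Re (c * chi i j a) <= complex.Re (c * psi i j a)].
Proof.
move=> bK [FK [phi0 F0] Fc Ff]; set f := fun chi : kern => complex.Re (c * chi i j a).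
have [M MP] := bK i j a.
have fM chi : F chi -> f chi <= complex.Re (`|c| * M%:C).
  move=> /FK /MP h; rewrite -lecR RRe_real; last first.
    by apply: rpredM; rewrite ?normr_real // complex_real.
  apply: le_trans (_ : `|c * chi i j a| <= _); last first.
    by rewrite normrM ler_wpM2l.
  by apply: le_trans (normc_ge_Re _); rewrite lecR ler_norm.
pose S := [set f chi | chi in F].
have Ssup : has_sup S.
  split; first by exists (f phi0), phi0.
  by exists (complex.Re (`|c| * M%:C)) => _ [chi Fchi <-]; exact: fM.
split.
- by move=> psi [/FK].
(* Near-maximisers generate a filter; a limit along a finer ultrafilter attains the supremum. *)
- pose G := filter_from [set e : R | 0 < e] (fun e => [set chi | F chi /\ sup S - e <= f chi]).
  have GP : ProperFilter G.
    apply: filter_from_proper; last first.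
      move=> e /= e0; have [_ [chi Fchi <-] h] := sup_adherent e0 Ssup.
      by exists chi; split=> //; exact: ltW.
    apply: filter_from_filter; first by exists 1 => /=.
    move=> e1 e2 /= h1 h2; exists (Num.min e1 e2); first by rewrite /= lt_min h1.
    move=> chi [Fchi h]; split; split=> //; apply: le_trans h; rewrite lerB //.
      by rewrite ge_min lexx.
    by rewrite ge_min lexx orbT.
  have [U [UU GU]] := ultraFilterLemma GP.
  have UP : ProperFilter U := @ultra_proper _ _ UU.
  have UF : U F by apply: GU; exists 1 => //= chi [].
  have [phi phiP] := ptwise_bounded_lim bK UU (filterS FK UF).
  exists phi; split; first exact: Fc UF _ phiP.
  move=> chi Fchi; apply: le_trans (_ : sup S <= _).
    by apply: sup_upper_bound => //; exists chi.
  apply/ler_addgt0Pr => e e0; rewrite -lerBlDr -lerN2 -raddfN -mulNr.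
  apply: (clim_Re_le UP (phiP i j a)); apply: GU; exists e => // psi [_] /=.
  by rewrite mulNr raddfN lerN2.
- move=> U UU UB phi phiP; have UP : ProperFilter U := @ultra_proper _ _ UU.
  split; first by apply: Fc phiP => //; apply: filterS UB => psi [].
  move=> chi Fchi; rewrite -lerN2 -raddfN -mulNr.
  apply: (clim_Re_le UP (phiP i j a)); apply: filterS UB => psi [_ /(_ _ Fchi)].
  by rewrite /= mulNr raddfN lerN2.
- move=> phi psi1 psi2 [Fphi pm] K1 K2 m.
  have [F1 F2] := Ff _ _ _ Fphi K1 K2 m.
  have E : complex.Re (c * psi1 i j a) + complex.Re (c * psi2 i j a) =
      2 * complex.Re (c * phi i j a).
    rewrite -raddfD /= -mulrDr m mulrCA mulrC [LHS]/=.
    by rewrite mulr_natr mulr2n raddfD mulr_natl mulr2n.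
  have := pm _ F1; have := pm _ F2.
  by split; split=> // chi /pm; lra.
Qed.

(** The existence half of the Krein-Milman argument: a minimal closed face is a single point. *)
Lemma extreme_kernel_ex K : K !=set0 -> ptwise_bounded K -> ultraclosed K ->
  exists2 phi, K phi & forall psi1 psi2, K psi1 -> K psi2 ->
    (forall i j a, psi1 i j a + psi2 i j a = 2 * phi i j a) -> psi1 = phi.
Proof.
move=> K0 bK cK.
(* Faces are handled through their complements because Zorn's lemma is applied to unions of
   chains. *)
pose P B := B `<=` K /\ kface K (K `\` B).
have [|B [[BK [FK [phi Fphi] Fc Ff]] Bmax]] := @Zorn_bigcup _ P.
  move=> H HP Htot; split; first by move=> psi [B /HP[BK _] /BK].
  split; first by move=> psi [].
  - have [H0|/forallNP H0] := pselect (exists B, H B); last first.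
      have [phi Kphi] := K0; exists phi; split=> // -[B HB _].
      exact: H0 HB.
    pose G := filter_from H (fun B => K `\` B).
    have GP : ProperFilter G.
      apply: filter_from_proper; last by move=> B /HP[_ []].
      apply: filter_from_filter; first exact: H0.
      move=> B1 B2 H1 H2; have [B12|B21] := Htot _ _ H1 H2.
        by exists B2 => // psi [Kpsi nB]; split; split=> // /B12.
      by exists B1 => // psi [Kpsi nB]; split; split=> // /B21.
    have [U [UU GU]] := ultraFilterLemma GP.
    have UB B : H B -> U (K `\` B) by move=> HB; apply: GU; exists B.
    have [B0 HB0] := H0.
    have UK : U K by apply: filterS (UB _ HB0) => psi [].
    have [phi phiP] := ptwise_bounded_lim bK UU UK.
    exists phi; split; first exact: cK UK _ phiP.
    move=> [B HB Bphi]; have [_ [_ _ Fc _]] := HP _ HB.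
    by have [_] := Fc U UU (UB _ HB) _ phiP.
  - move=> U UU UB phi phiP; split.
      by apply: cK phiP => //; apply: filterS UB => psi [].
    move=> [B HB Bphi]; have [_ [_ _ Fc _]] := HP _ HB.
    have [|_] := Fc U UU _ _ phiP; last by [].
    by apply: filterS UB => psi [Kpsi nB]; split=> // Bpsi; apply: nB; exists B.
  - move=> phi psi1 psi2 [Kphi nphi] K1 K2 m.
    have key B : H B -> ~ B psi1 /\ ~ B psi2.
      move=> HB; have [_ [_ _ _ Ff]] := HP _ HB.
      have [|[_ ?] [_ ?]] := Ff _ _ _ _ K1 K2 m; last by [].
      by split=> // Bphi; apply: nphi; exists B.
    by split; split=> // -[B /key[]].
exists phi; first by case: Fphi.
have Fmin F : kface K F -> F `<=` K `\` B -> K `\` B `<=` F.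
  move=> Fface FB psi [Kpsi nB]; have [FK' _ _ _] := Fface.
  apply: contrapT => nF; apply: (Bmax (K `\` F)).
    split; last by move=> /(_ psi (conj Kpsi nF)).
    by move=> chi Bchi; split; [exact: BK | move=> /FB[]].
  by split; [move=> chi [] | rewrite setDD (setIidr FK')].
(* A minimal face coincides with its set of maximisers for each functional, so every functional is
   constant on it. *)
have Fcst c psi chi i j a : (K `\` B) psi -> (K `\` B) chi ->
    complex.Re (c * psi i j a) <= complex.Re (c * chi i j a).
  move=> Fpsi Fchi.
  have [|_] := Fmin _ (kface_max c i j a bK (And4 FK (ex_intro _ phi Fphi) Fc Ff)) _ chi Fchi.
    by move=> ? [].
  exact.
have Feq psi : (K `\` B) psi -> psi = phi.
  move=> Fpsi; apply/funext => i; apply/funext => j; apply/funext => a.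
  have E c : complex.Re (c * psi i j a) = complex.Re (c * phi i j a).
    by apply/eqP; rewrite eq_le !Fcst.
  have := E 1; have := E 'i%C.
  case: (psi i j a) (phi i j a) => u v [u' v'] /=.
  by rewrite !mul0r !mul1r !sub0r !subr0 => /oppr_inj -> ->.
by move=> psi1 psi2 K1 K2 m; apply: Feq; have [] := Ff _ _ _ Fphi K1 K2 m.
Qed.

End ExtremeKernels.

(** * Decomposition into pure kernels *)

Section PureDecomposition.
Variables (R : realType) (A : unitalCStarType R) (I : finType).
Local Notation C := R[i].
Local Notation kern := (akernel A I).
Implicit Types (phi psi chi theta : kern).

(** Generators of the extreme rays of the cone of positive kernels. *)
Definition pure_kernel chi := [/\ poskern chi, (exists i, chi i i 1 != 0) &
  forall (M : R) theta, 0 <= M -> poskern theta -> poskern (aksub (akscale M%:C chi) theta) ->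
    exists2 c : R, 0 <= c & theta = akscale c%:C chi].

(** Membership in the face of the cone generated by [phi]. *)
Definition kdominated phi theta := poskern theta /\
  exists2 M : R, 0 <= M & poskern (aksub (akscale M%:C phi) theta).

Definition real_free k (psi : 'I_k -> kern) := forall c : 'I_k -> R,
  (forall i j a, \sum_l (c l)%:C * psi l i j a = 0) -> forall l, c l = 0.

Definition face_rank_le phi d := forall k (psi : 'I_k -> kern),
  (forall l, kdominated phi (psi l)) -> real_free psi -> (k <= d)%N.

Lemma poskern_nonzero phi : poskern phi -> phi <> (fun _ _ _ => 0) -> exists i, phi i i 1 != 0.
Proof.
move=> phiP phi0; apply: contrapT => /forallNP H; apply: phi0.
apply/funext => i; apply/funext => j; apply/funext => a; apply: kern_null => //.
by left; apply/eqP; have /negP := H i; rewrite negbK.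
Qed.

Lemma kdominated_refl phi : poskern phi -> kdominated phi phi.
Proof.
move=> phiP; split=> //; exists 1 => //.
have -> : aksub (akscale 1%:C phi) phi = fun _ _ _ => 0; last exact: poskern0.
by apply/funext => i; apply/funext => j; apply/funext => a; rewrite /aksub /akscale mul1r subrr.
Qed.

Lemma kdominated_le phi theta : poskern theta -> poskern (aksub phi theta) -> kdominated phi theta.
Proof.
move=> thetaP h; split=> //; exists 1 => //.
have -> // : aksub (akscale 1%:C phi) theta = aksub phi theta.
by apply/funext => i; apply/funext => j; apply/funext => a; rewrite /aksub /akscale mul1r.
Qed.

Lemma ge0_rC (r : R) : 0 <= r -> 0 <= r%:C :> C.
Proof. by rewrite (lecR 0). Qed.

Lemma rC_eq0 (r : R) : (r%:C == 0 :> C) = (r == 0).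
Proof. exact: (inj_eq (@complexI R) r 0). Qed.

Lemma kdominated_trans phi psi theta :
  kdominated phi psi -> kdominated psi theta -> kdominated phi theta.
Proof.
move=> [psiP [M M0 MP]] [thetaP [N N0 NP]]; split=> //.
exists (N * M); first exact: mulr_ge0.
have := poskern_add (poskern_scale (ge0_rC N0) MP) NP.
congr poskern; apply/funext => i; apply/funext => j; apply/funext => a.
by rewrite /akadd /aksub /akscale rmorphM /= mulrBr mulrA addrA subrK.
Qed.

(** The value at [(i0, i0, 1)] bounds the admissible multiples and the cone is closed, so a largest
    multiple exists. *)
Lemma poskern_max_sub phi theta : poskern phi -> poskern theta ->
  (exists i, phi i i 1 != 0) -> exists2 t : R, 0 <= t &
  poskern (aksub theta (akscale t%:C phi)) /\
  forall e : R, 0 < e -> ~ poskern (aksub (aksub theta (akscale t%:C phi)) (akscale e%:C phi)).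
Proof.
move=> phiP thetaP [i0 phi0].
have f0 : 0 < phi i0 i0 1 by rewrite lt_neqAle eq_sym phi0 kern_diag_ge0.
have RE (z : C) : 0 <= z -> (complex.Re z)%:C = z by move=> /ger0_real /RRe_real.
set f := complex.Re (phi i0 i0 1); have fE : f%:C = phi i0 i0 1 by apply: RE; exact: ltW.
have fp : 0 < f by rewrite -(ltcR 0) fE.
set g := complex.Re (theta i0 i0 1).
have gE : g%:C = theta i0 i0 1 by apply: RE; exact: kern_diag_ge0.
pose S := [set t : R | 0 <= t /\ poskern (aksub theta (akscale t%:C phi))].
have S0 : S 0.
  split=> //; move: thetaP; congr poskern.
  by apply/funext => i; apply/funext => j; apply/funext => a; rewrite /aksub /akscale mul0r subr0.
have Ssup : has_sup S.
  split; first by exists 0.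
  exists (g / f) => t [t0 tP]; rewrite ler_pdivlMr // -subr_ge0 -(lecR 0).
  by rewrite rmorphB rmorphM /= fE gE; exact: (kern_diag_ge0 tP).
have t0 : 0 <= sup S by apply: sup_upper_bound.
have scL t : forall i j, scalar (aksub theta (akscale t phi) i j).
  by move=> i j c a b; rewrite /aksub /akscale thetaP.1 phiP.1; ring.
exists (sup S) => //; split.
  split=> [|s]; first exact: scL.
  rewrite kform_sub kform_scale subr_ge0.
  have h t : S t -> t%:C * kform phi s s <= kform theta s s.
    by move=> [_ [_ /(_ s)]]; rewrite kform_sub kform_scale subr_ge0.
  have p0 := phiP.2 s; have q0 := thetaP.2 s.
  move: h; rewrite -(RE _ p0) -(RE _ q0); set p := complex.Re _; set q := complex.Re _.
  move=> h; rewrite -rmorphM lecR.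
  have [p0'|p1] := eqVneq p 0; first by rewrite p0' mulr0 -(lecR 0) RE.
  have pp : 0 < p by rewrite lt_neqAle eq_sym p1 -(lecR 0) RE.
  rewrite -ler_pdivlMr //; apply: ge_sup; first by exists 0.
  by move=> t /h; rewrite -rmorphM lecR ler_pdivlMr.
move=> e e0 eP.
have : S (sup S + e).
  split; first by rewrite addr_ge0 // ltW.
  move: eP; congr poskern; apply/funext => i; apply/funext => j; apply/funext => a.
  by rewrite /aksub /akscale rmorphD /= mulrDl opprD addrA.
by move=> /(sup_upper_bound Ssup); rewrite gerDl leNgt e0.
Qed.

(** A real combination of kernels dominated by [psi] lies below a multiple of [psi]; if [chi] were
    one, a positive multiple of it could be subtracted from [psi]. So adding [chi] to a free family
    of the face of [psi] keeps it free. *)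
Lemma face_rank_drop phi psi chi d : kdominated phi chi -> kdominated phi psi ->
  (forall e : R, 0 < e -> ~ poskern (aksub psi (akscale e%:C chi))) ->
  face_rank_le phi d.+1 -> face_rank_le psi d.
Proof.
move=> dchi dpsi nchi rk k w dw fw; rewrite -ltnS.
apply: (rk k.+1 (fun l => if unlift ord0 l is Some l' then w l' else chi)).
  by move=> l; case: unliftP => [l' _|_] //; apply: kdominated_trans (dw l').
move=> c cP.
have {}cP i j a : (c ord0)%:C * chi i j a + \sum_l (c (lift ord0 l))%:C * w l i j a = 0.
  rewrite -[RHS](cP i j a) big_ord_recl unlift_none; congr (_ + _).
  by apply: eq_bigr => l _; rewrite liftK.
have [c0|c0] := eqVneq (c ord0) 0.
  have cl : forall l, c (lift ord0 l) = 0.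
    by apply: fw => i j a; rewrite -[RHS](cP i j a) c0 mul0r add0r.
  by move=> l; case: (unliftP ord0 l) => [l' ->|-> //].
exfalso.
have /choice[M MP] l : exists M : R, 0 <= M /\ poskern (aksub (akscale M%:C psi) (w l)).
  by have [_ [M M0 h]] := dw l; exists M.
pose e l := - c (lift ord0 l) / c ord0.
have chiE i j a : chi i j a = \sum_l (e l)%:C * w l i j a.
  have c0' : (c ord0)%:C != 0 by rewrite rC_eq0.
  apply: (mulfI c0'); rewrite mulr_sumr.
  move/eqP: (cP i j a); rewrite addr_eq0 => /eqP ->; rewrite -sumrN.
  apply: eq_bigr => l _; rewrite mulrA -rmorphM /= /e.
  by rewrite [c ord0 * _]mulrC divfK // rmorphN mulNr.
pose N := \sum_l `|e l| * M l.
have N0 : 0 <= N by apply: sumr_ge0 => l _; rewrite mulr_ge0 // (MP l).1.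
apply: (nchi (N + 1)^-1); first by rewrite invr_gt0 ltr_wpDl.
have chiP := dchi.1; have psiP := dpsi.1.
have L t : forall i j, scalar (aksub psi (akscale t chi) i j).
  by move=> i j z a b; rewrite /aksub /akscale psiP.1 chiP.1; ring.
split=> // s; rewrite kform_sub kform_scale subr_ge0.
have N1 : 0 < N + 1 by rewrite ltr_wpDl.
rewrite -(ler_pM2l (_ : 0 < (N + 1)%:C)) ?(ltcR 0) // mulrA -rmorphM mulfV ?gt_eqF // mul1r.
have -> : kform chi s s = \sum_l (e l)%:C * kform (w l) s s.
  rewrite /kform (eq_bigr (fun p => \sum_l \sum_(r <- s) (e l)%:C * w l p.1 r.1 (cstar p.2 * r.2))).
    rewrite exchange_big; apply: eq_bigr => l _; rewrite mulr_sumr.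
    by apply: eq_bigr => p _; rewrite mulr_sumr.
  by move=> p _; rewrite exchange_big; apply: eq_bigr => r _; exact: chiE.
apply: le_trans (_ : \sum_l (`|e l| * M l)%:C * kform psi s s <= _); last first.
  rewrite -mulr_suml -rmorph_sum ler_wpM2r ?psiP.2 // lecR.
  by rewrite -/N lerDl.
apply: ler_sum => l _; apply: le_trans (_ : `|e l|%:C * kform (w l) s s <= _).
  by rewrite ler_wpM2r ?(dw l).1.2 // lecR ler_norm.
rewrite rmorphM -mulrA ler_wpM2l ?ge0_rC //.
by have := (MP l).2.2 s; rewrite kform_sub kform_scale subr_ge0.
Qed.

Definition pure_sum phi := exists n (chi : 'I_n -> kern),
  (forall k, pure_kernel (chi k)) /\ phi = fun i j a => \sum_k chi k i j a.

Lemma pure_sum_cons chi phi : pure_kernel chi -> pure_sum phi -> pure_sum (akadd chi phi).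
Proof.
move=> chiP [n [w [wP ->]]].
exists n.+1, (fun l => if unlift ord0 l is Some l' then w l' else chi); split.
  by move=> l; case: unliftP.
apply/funext => i; apply/funext => j; apply/funext => a.
rewrite big_ord_recl unlift_none; congr (_ + _).
by apply: eq_bigr => l _; rewrite liftK.
Qed.

Lemma pure_kernel_scale (t : R) chi : 0 < t -> pure_kernel chi -> pure_kernel (akscale t%:C chi).
Proof.
move=> t0 [chiP [i i0] pure]; split; first by apply: poskern_scale => //; exact/ge0_rC/ltW.
  by exists i; rewrite /akscale mulf_neq0 // rC_eq0 gt_eqF.
move=> M theta M0 thetaP le.
have [||c c0 ->] := pure (M * t) theta _ thetaP; first by rewrite mulr_ge0 // ltW.
  move: le; congr poskern; apply/funext => k; apply/funext => j; apply/funext => a.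
  by rewrite /aksub /akscale rmorphM mulrA.
exists (c / t); first by rewrite divr_ge0 // ltW.
apply/funext => k; apply/funext => j; apply/funext => a.
by rewrite /akscale mulrA -rmorphM /= divfK // gt_eqF.
Qed.

(* Subtracting the largest multiple of [phi] from a dominated [theta] that is
   not proportional to it lowers the rank; this gives a pure [chi] below [phi],
   whose largest multiple is then subtracted from [phi]. *)
Lemma pure_sum_of_rank d phi : poskern phi -> face_rank_le phi d -> pure_sum phi.
Proof.
elim: d phi => [|d IH] phi phiP rk;
  have [phi0|/(poskern_nonzero phiP) phi1] := pselect (phi = fun _ _ _ => 0);
  try by [exists 0, (fun=> phi); split=> [[]//|]; rewrite phi0;
    apply/funext => i; apply/funext => j; apply/funext => a; rewrite big_ord0].
  (* A nonzero [phi] would itself be a free family of length one. *)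
  have [] := @negP (1 <= 0)%N isT; apply: (rk 1 (fun=> phi)).
    by move=> _; exact: kdominated_refl.
  move=> c cP l; have [i /negP i0] := phi1; apply: contrapT => cl; apply: i0.
  have := cP i i 1; rewrite big_ord1 => /eqP; rewrite mulf_eq0 => /orP[|//].
  rewrite rC_eq0 => /eqP c0.
  by case: cl; rewrite (ord1 l).
have [/(pure_sum_cons (phi := fun _ _ _ => 0))|npure] := pselect (pure_kernel phi).
  have -> : akadd phi (fun _ _ _ => 0) = phi.
    by apply/funext => i; apply/funext => j; apply/funext => a; rewrite /akadd addr0.
  apply; exists 0, (fun=> phi); split=> [[]//|].
  by apply/funext => i; apply/funext => j; apply/funext => a; rewrite big_ord0.
have [theta [dth nth]] : exists theta, kdominated phi theta /\
    forall c : R, 0 <= c -> theta <> akscale c%:C phi.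
  apply: contrapT => /forallNP H; apply: npure; split=> // M theta M0 thP le.
  apply: contrapT => nc; apply: (H theta); split; first by split=> //; exists M.
  by move=> c c0 e; apply: nc; exists c.
have [t t0 [thP' tmax]] := poskern_max_sub phiP dth.1 phi1.
set th' := aksub theta _ in thP' tmax.
have dth' : kdominated phi th'.
  apply: kdominated_trans dth _; apply: kdominated_le => //.
  have := poskern_scale (ge0_rC t0) phiP; congr poskern.
  by apply/funext => i; apply/funext => j; apply/funext => a; rewrite /th' /aksub subKr.
have [n [w [wP th'E]]] := IH th' thP' (face_rank_drop (kdominated_refl phiP) dth' tmax rk).
(* An empty sum would make [theta] the multiple [t] of [phi]. *)
case: n w wP th'E => [|n] w wP th'E.
  case: (nth _ t0); apply/funext => i; apply/funext => j; apply/funext => a.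
  have /(congr1 (fun f => f i j a)) := th'E.
  by rewrite big_ord0 /th' /aksub => /eqP; rewrite subr_eq0 => /eqP.
pose chi := w ord0; have chiP : poskern chi by have [] := wP ord0.
have chi1 : exists i, chi i i 1 != 0 by have [] := wP ord0.
have dchi : kdominated phi chi.
  apply: kdominated_trans dth' _; apply: kdominated_le => //.
  have := poskern_sum (phi := fun l : 'I_n => w (lift ord0 l))
    (fun l => let: And3 h _ _ := wP _ in h).
  congr poskern; apply/funext => i; apply/funext => j; apply/funext => a.
  by rewrite /aksub th'E big_ord_recl addrC addKr.
have [s s0 [psiP smax]] := poskern_max_sub chiP phiP chi1.
have dpsi : kdominated phi (aksub phi (akscale s%:C chi)).
  apply: kdominated_le => //; have := poskern_scale (ge0_rC s0) chiP; congr poskern.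
  by apply/funext => i; apply/funext => j; apply/funext => a; rewrite /aksub subKr.
have psiS := IH _ psiP (face_rank_drop dchi dpsi smax rk).
(* If [s] is 0, nothing was subtracted and [psiS] already decomposes [phi]. *)
have [s0'|s1] := eqVneq s 0.
  move: psiS; congr pure_sum; apply/funext => i; apply/funext => j; apply/funext => a.
  by rewrite /aksub /akscale s0' mul0r subr0.
have sp : 0 < s by rewrite lt_neqAle eq_sym s1.
have := pure_sum_cons (pure_kernel_scale sp (wP ord0)) psiS; congr pure_sum.
by apply/funext => i; apply/funext => j; apply/funext => a; rewrite /akadd /aksub subrKC.
Qed.

End PureDecomposition.

(** * Agreement on a finite set with a finite sum of pure kernels *)

Section PureApproximation.
Variables (R : realType) (A : unitalCStarType R) (I : finType).
Local Notation C := R[i].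
Local Notation kern := (akernel A I).
Implicit Types (phi psi chi theta : kern).

Lemma poskern_ulim (U : set_system kern) phi : UltraFilter U ->
  U [set psi | poskern psi] ->
  (forall i j a, clim U (fun psi => psi i j a) (phi i j a)) -> poskern phi.
Proof.
move=> UU Upos phiP; have UP : ProperFilter U := @ultra_proper _ _ UU.
split=> [i j c a b|s].
  have L := climB (FF := UP) (phiP i j (c *: a + b))
    (climD (FF := UP) (climZ (FF := UP) (c := c) (phiP i j a)) (phiP i j b)).
  apply/eqP; rewrite -subr_eq0; apply/eqP; apply: (clim_unique L).
  apply/climP => e e0; apply: filterS Upos => psi [psiL _] /=.
  by rewrite psiL subrr subr0 normr0 (ltcR 0).
have L : clim U (fun psi => kform psi s s) (kform phi s s).
  by apply: clim_sum => p; apply: clim_sum => r; exact: phiP.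
have /(clim_ge0 (FF := UP)) := L; apply => e e0.
apply: filterS Upos => psi [_ psi0] /=; apply: le_trans (psi0 s).
by rewrite oppr_le0 (lecR 0) ltW.
Qed.

Section Slice.
Variables (phi0 : kern) (s : seq A).
Hypothesis phi0P : poskern phi0.
Hypothesis s1 : 1 \in s.

Let K := [set psi : kern | poskern psi /\
  forall a, a \in s -> forall i j, psi i j a = phi0 i j a].

(** As [1] belongs to [s], the diagonal values at [1] are those of [phi0], and [kern_bound] extends
    the control to every entry. *)
Lemma slice_bounded : ptwise_bounded K.
Proof.
move=> i j a.
pose N := 2 * cnorm a ^+ 2 * (complex.Re (phi0 i i 1) * complex.Re (phi0 j j 1)).
have RE k : (complex.Re (phi0 k k 1))%:C = phi0 k k 1.
  by apply: RRe_real; apply: ger0_real; exact: kern_diag_ge0.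
have R0 k : 0 <= complex.Re (phi0 k k 1) by rewrite -(lecR 0) RE; exact: kern_diag_ge0.
have N0 : 0 <= N by apply: mulr_ge0; apply: mulr_ge0; rewrite ?sqr_ge0 ?R0.
exists (Num.sqrt N) => psi [psiP psi0].
rewrite -(ler_pXn2r (_ : (0 < 2)%N)) ?nnegrE ?normr_ge0 ?(lecR 0) ?sqrtr_ge0 //.
apply: le_trans (kern_bound psiP _ _ _) _.
rewrite -rmorphXn /= sqr_sqrtr // !psi0 //.
by rewrite -(RE i) -(RE j) -!rmorphM.
Qed.

Lemma slice_ultraclosed : ultraclosed K.
Proof.
move=> U UU UK phi phiP; have UP : ProperFilter U := @ultra_proper _ _ UU.
split; first by apply: poskern_ulim phiP => //; apply: filterS UK => psi [].
move=> a sa i j; apply: (clim_unique (phiP i j a)).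
apply/climP => e e0; apply: filterS UK => psi [_ /(_ a sa i j)] /= ->.
by rewrite subrr normr0 (ltcR 0).
Qed.

(* Too many independent elements of the face would have a real combination
   vanishing on [s], along which [phi] could be moved both ways in the slice. *)
Lemma extreme_face_rank phi : K phi ->
  (forall psi1 psi2, K psi1 -> K psi2 ->
    (forall i j a, psi1 i j a + psi2 i j a = 2 * phi i j a) -> psi1 = phi) ->
  exists d, face_rank_le phi d.
Proof.
(* Each entry with argument in [s] imposes two real conditions, the [bool] selecting the real or the
   imaginary part; more than [#|Q|] kernels thus satisfy a real relation on [s]. *)
move=> [phiP phis] ext; pose Q : finType := (I * I * 'I_(size s) * bool)%type.
exists #|Q| => k w dw fw; rewrite leqNgt; apply/negP => ltk.
pose ev (psi : kern) (x : Q) : R :=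
  let z := psi x.1.1.1 x.1.1.2 (nth 0 s x.1.2) in
  if x.2 then complex.Re z else complex.Im z.
pose M := \matrix_(l < k, x < #|Q|) ev (w l) (enum_val x).
have kerM : kermx M != 0.
  rewrite kermx_eq0 /row_free neq_ltn; apply/orP; left.
  by apply: leq_ltn_trans ltk; exact: rank_leq_col.
have [v /sub_kermxP vM v0] := rowV0Pn kerM.
pose c l := v 0 l.
pose D : kern := fun i j a => \sum_l (c l)%:C * w l i j a.
have RI (z : C) : complex.Re z = 0 -> complex.Im z = 0 -> z = 0.
  by case: z => x y /= -> ->.
have Ds a : a \in s -> forall i j, D i j a = 0.
  move=> sa i j; have ia : (index a s < size s)%N by rewrite index_mem.
  have E b : \sum_l c l * ev (w l) (i, j, Ordinal ia, b) = 0.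
    have /rowP/(_ (enum_rank (i, j, Ordinal ia, b))) := vM.
    rewrite mxE [RHS]mxE => h; rewrite -[RHS]h.
    by apply: eq_bigr => l _; rewrite [M _ _]mxE enum_rankK.
  have := E true; have := E false; rewrite /ev /= nth_index // => Ei Er.
  apply: RI; rewrite /D raddf_sum /=.
    by rewrite -[RHS]Er; apply: eq_bigr => l _; case: (w l i j a) => x y /=; rewrite mul0r subr0.
  by rewrite -[RHS]Ei; apply: eq_bigr => l _; case: (w l i j a) => x y /=; rewrite mul0r addr0.
have /choice[N NP] l : exists N : R, 0 <= N /\ poskern (aksub (akscale N%:C phi) (w l)).
  by have [_ [N N0 h]] := dw l; exists N.
pose S := \sum_l `|c l| * N l.
have S0 : 0 <= S by apply: sumr_ge0 => l _; rewrite mulr_ge0 // (NP l).1.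
have S1 : 0 < 1 + S by rewrite ltr_wpDr.
(* [D] lies between -S and S times [phi], so phi + e D and phi - e D remain positive. *)
pose e := (1 + S)^-1.
have Dform t : kform D t t = \sum_l (c l)%:C * kform (w l) t t.
  rewrite /kform (eq_bigr (fun p => \sum_l \sum_(r <- t) (c l)%:C * w l p.1 r.1 (cstar p.2 * r.2))).
    rewrite exchange_big; apply: eq_bigr => l _; rewrite mulr_sumr.
    by apply: eq_bigr => p _; rewrite mulr_sumr.
  by move=> p _; rewrite exchange_big.
have DL i j : scalar (D i j).
  move=> z a b; rewrite /D mulr_sumr -big_split; apply: eq_bigr => l _ /=.
  by rewrite (dw l).1.1; ring.
have Kpm (d : R) : `|d| = e -> K (akadd phi (akscale d%:C D)).
  move=> de; split; last first.
    by move=> a sa i j; rewrite /akadd /akscale Ds // mulr0 addr0 phis.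
  split=> [i j z a b|t]; first by rewrite /akadd /akscale phiP.1 DL; ring.
  rewrite kform_add kform_scale Dform.
  have h l : - ((`|c l| * N l)%:C * kform phi t t) <= (d / e * c l)%:C * kform (w l) t t.
    have e0 : 0 < e by rewrite invr_gt0.
    apply: le_trans (_ : - (`|c l|%:C * kform (w l) t t) <= _).
      rewrite lerN2 rmorphM -mulrA ler_wpM2l ?ge0_rC //.
      by have := (NP l).2.2 t; rewrite kform_sub kform_scale subr_ge0.
    rewrite -mulNr ler_wpM2r ?(dw l).1.2 // -rmorphN lecR.
    have <- : `|d / e * c l| = `|c l|.
      by rewrite !normrM normfV de (gtr0_norm e0) mulfV ?mul1r ?gt_eqF.
    by rewrite lerNl -normrN ler_norm.
  have e0 : 0 < e by rewrite invr_gt0.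
  have -> : d%:C * (\sum_l (c l)%:C * kform (w l) t t) =
      e%:C * \sum_l (d / e * c l)%:C * kform (w l) t t.
    rewrite !mulr_sumr; apply: eq_bigr => l _.
    by rewrite !mulrA -!rmorphM /= mulrA [e * _]mulrC divfK ?gt_eqF.
  apply: le_trans (_ : kform phi t t + e%:C * \sum_l - ((`|c l| * N l)%:C * kform phi t t) <= _).
    rewrite sumrN -mulr_suml -rmorph_sum mulrN mulrA -rmorphM /= -/S.
    rewrite -{1}[kform phi t t]mul1r -mulrBl mulr_ge0 ?phiP.2 //.
    rewrite -[1]/(1%:C) -rmorphB /= ge0_rC // subr_ge0 /e mulrC ler_pdivrMr // mul1r.
    by rewrite lerDr.
  rewrite lerD2l ler_wpM2l ?ge0_rC ?(ltW e0) //.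
  by apply: ler_sum => l _; exact: h.
have e0 : 0 < e by rewrite invr_gt0.
have := ext _ _ (Kpm e (gtr0_norm e0)) (Kpm (- e) _).
rewrite normrN (gtr0_norm e0) => /(_ erefl) H.
have {}H : akadd phi (akscale e%:C D) = phi.
  by apply: H => i j a; rewrite /akadd /akscale rmorphN; ring.
have cl : forall l, c l = 0.
  apply: fw => i j a; have /(congr1 (fun f => f i j a)) := H.
  rewrite /akadd /akscale -[RHS]addr0 => /addrI /eqP.
  by rewrite mulf_eq0 rC_eq0 gt_eqF //= => /eqP.
by case/negP: v0; apply/eqP/rowP => l; rewrite mxE; exact: cl.
Qed.

Lemma pure_approximation : exists2 phi, pure_sum phi &
  forall a, a \in s -> forall i j, phi i j a = phi0 i j a.
Proof.
have K0 : K !=set0 by exists phi0.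
have [phi Kphi ext] := extreme_kernel_ex K0 slice_bounded slice_ultraclosed.
have [d rk] := extreme_face_rank Kphi ext.
by exists phi; [exact: pure_sum_of_rank Kphi.1 rk | exact: Kphi.2].
Qed.

End Slice.
End PureApproximation.

(** * Cholesky factorization *)

Section Cholesky.
Variables (C : numClosedFieldType) (I : finType).
Implicit Types (B L : I -> I -> C) (x y : I -> C).

Definition mxform B x y : C := \sum_i \sum_j conjC (y i) * x j * B i j.
Definition psd_mx B := forall x, 0 <= mxform B x x.

Let mxformDl B x y z : mxform B (fun i => x i + y i) z = mxform B x z + mxform B y z.
Proof.
rewrite /mxform -big_split; apply: eq_bigr => i _; rewrite -big_split.
by apply: eq_bigr => j _ /=; ring.
Qed.

Let mxformDr B x y z : mxform B z (fun i => x i + y i) = mxform B z x + mxform B z y.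
Proof.
rewrite /mxform -big_split; apply: eq_bigr => i _; rewrite -big_split.
by apply: eq_bigr => j _ /=; rewrite rmorphD /=; ring.
Qed.

Let mxformZl B c x y : mxform B (fun i => c * x i) y = c * mxform B x y.
Proof.
rewrite /mxform mulr_sumr; apply: eq_bigr => i _; rewrite mulr_sumr.
by apply: eq_bigr => j _ /=; ring.
Qed.

Let mxformZr B c x y : mxform B x (fun i => c * y i) = conjC c * mxform B x y.
Proof.
rewrite /mxform mulr_sumr; apply: eq_bigr => i _; rewrite mulr_sumr.
by apply: eq_bigr => j _ /=; rewrite rmorphM /=; ring.
Qed.

Let delta k : I -> C := fun i => (i == k)%:R.

Lemma sum_delta (f : I -> C) k : \sum_i (i == k)%:R * f i = f k.
Proof.
rewrite (bigD1 k) //= eqxx mul1r big1 ?addr0 // => i /negPf ->.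
by rewrite mul0r.
Qed.

Lemma mxform_delta B x k : mxform B x (delta k) = \sum_j x j * B k j.
Proof.
rewrite /mxform -[RHS](sum_delta (fun i => \sum_j x j * B i j)).
apply: eq_bigr => i _; rewrite mulr_sumr; apply: eq_bigr => j _.
by rewrite /delta conjC_nat mulrA.
Qed.

Lemma mxform_delta2 B k l : mxform B (delta l) (delta k) = B k l.
Proof. by rewrite mxform_delta sum_delta. Qed.

Section Psd.
Variable B : I -> I -> C.
Hypothesis B0 : psd_mx B.

Lemma mx_CS x y : `|mxform B x y| ^+ 2 <= mxform B x x * mxform B y y.
Proof.
exact: (psd_CauchySchwarz (mxformDl B) (fun x y z => mxformDr B x y z)
  (mxformZl B) (mxformZr B) B0).
Qed.

Lemma psd_diag_ge0 k : 0 <= B k k.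
Proof. by rewrite -mxform_delta2. Qed.

Lemma psd_row0 k l : B k k = 0 -> B k l = 0.
Proof.
move=> k0; have := mx_CS (delta l) (delta k); rewrite !mxform_delta2 k0 mulr0.
by move=> h; apply/eqP; rewrite -normr_eq0 -sqrf_eq0 eq_le h exprn_ge0.
Qed.

Let piv k : I -> C := fun j => B k j / sqrtC (B k k).

(** The Schur complement at [k], positive by Cauchy-Schwarz against the basis vector [k]. If
    [B k k = 0], division by zero makes [piv k] zero and nothing is subtracted. *)
Lemma psd_pivot k : psd_mx (fun i j => B i j - conjC (piv k i) * piv k j).
Proof.
move=> x; set z := \sum_j x j * piv k j.
have -> : mxform (fun i j => B i j - conjC (piv k i) * piv k j) x x =
    mxform B x x - `|z| ^+ 2.
  rewrite normCK /z rmorph_sum mulrC /mxform big_distrlr /= -sumrB.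
  apply: eq_bigr => i _; rewrite -sumrB; apply: eq_bigr => j _.
  by rewrite [conjC (x i * _)]rmorphM /=; ring.
rewrite subr_ge0; have -> : z = mxform B x (delta k) / sqrtC (B k k).
  by rewrite mxform_delta mulr_suml; apply: eq_bigr => j _; rewrite mulrA.
have [k0|k0] := eqVneq (B k k) 0; first by rewrite k0 sqrtC0 invr0 mulr0 normr0 expr0n.
have kp : 0 < B k k by rewrite lt_neqAle eq_sym k0 psd_diag_ge0.
rewrite normrM normfV exprMn exprVn (ger0_norm (_ : 0 <= sqrtC (B k k))) ?sqrtC_ge0 ?(ltW kp) //.
by rewrite sqrtCK ler_pdivrMr // -[B k k]mxform_delta2 mx_CS.
Qed.

Lemma psd_pivot0 k j : B k j - conjC (piv k k) * piv k j = 0.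
Proof.
have [k0|k0] := eqVneq (B k k) 0.
  by rewrite /piv !(psd_row0 _ k0) !mul0r mulr0 subr0.
have s0 : sqrtC (B k k) != 0 by rewrite sqrtC_eq0.
have -> : piv k k = sqrtC (B k k) by rewrite /piv -{1}(sqrtCK (B k k)) expr2 mulfK.
rewrite (geC0_conj (_ : 0 <= sqrtC (B k k))) ?sqrtC_ge0 ?psd_diag_ge0 //.
by rewrite /piv mulrC divfK // subrr.
Qed.

End Psd.

(** Elimination along [s], one pivot at a time. The clause on null diagonal entries will later
    confine [L] to prescribed indices. *)
Lemma cholesky_partial (s : seq I) B : uniq s -> psd_mx B -> exists L,
  [/\ forall m, m \notin s -> forall j, L m j = 0,
      psd_mx (fun i j => B i j - \sum_m conjC (L m i) * L m j),
      forall i j, i \in s -> B i j - \sum_m conjC (L m i) * L m j = 0 &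
      forall m j, B m m = 0 -> L m j = 0].
Proof.
elim: s B => [|k s IH] B.
  move=> _ B0; exists (fun _ _ => 0); split=> //.
  move=> x; have := B0 x; congr (0 <= _).
  apply: eq_bigr => i _; apply: eq_bigr => j _; congr (_ * _).
  by rewrite big1 ?subr0 // => m _; rewrite mulr0.
move=> /= /andP[ks us] B0; pose l j := B k j / sqrtC (B k k).
pose B1 i j := B i j - conjC (l i) * l j.
have B10 : psd_mx B1 by exact: psd_pivot.
have [L [Ls R0 Rs L0]] := IH B1 us B10.
pose L' m := if m == k then l else L m.
have E i j : B i j - \sum_m conjC (L' m i) * L' m j = B1 i j - \sum_m conjC (L m i) * L m j.
  rewrite (bigD1 k) //= [in RHS](bigD1 k) //= /L' eqxx (Ls k ks j) mulr0 add0r opprD addrA.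
  by congr (_ - _); apply: eq_bigr => m /negPf ->.
have R0' : psd_mx (fun i j => B i j - \sum_m conjC (L' m i) * L' m j).
  move=> x; have := R0 x; congr (0 <= _).
  by apply: eq_bigr => i _; apply: eq_bigr => j _; rewrite E.
exists L'; split=> //.
- move=> m; rewrite in_cons negb_or => /andP[/negPf mk ms] j.
  by rewrite /L' mk Ls.
- move=> i j; rewrite in_cons E => /orP[/eqP ->|]; last exact: Rs.
  (* The residue is positive and its entry at [(k, k)] is at most [B1 k k = 0], so its row [k]
     vanishes. *)
  apply: (psd_row0 R0); apply/eqP; rewrite eq_le (psd_diag_ge0 R0) andbT.
  rewrite [B1 k k]psd_pivot0 // sub0r oppr_le0 sumr_ge0 // => m _.
  by rewrite mulrC -normCK exprn_ge0.
- move=> m j m0; rewrite /L'; case: eqP => [mk|_].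
    by rewrite /l -mk (psd_row0 B0) // mul0r.
  apply: L0; apply/eqP; rewrite eq_le (psd_diag_ge0 B10) andbT /B1 m0 sub0r oppr_le0.
  by rewrite mulrC -normCK exprn_ge0.
Qed.

(* Here [i0] is the first pivot. *)
Lemma cholesky i0 B : psd_mx B -> exists L,
  [/\ forall i j, B i j = \sum_m conjC (L m i) * L m j,
      forall m, m != i0 -> L m i0 = 0 &
      forall m j, B m m = 0 -> L m j = 0].
Proof.
move=> B0; pose l j := B i0 j / sqrtC (B i0 i0).
pose B1 i j := B i j - conjC (l i) * l j.
have B10 : psd_mx B1 by exact: psd_pivot.
have [L [Ls R0 Rs L0]] := cholesky_partial (rem_uniq i0 (enum_uniq I)) B10.
have i0s : i0 \notin rem i0 (enum I) by rewrite mem_rem_uniq ?enum_uniq // !inE eqxx.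
have B1i0 j : B1 i0 j = 0 by exact: psd_pivot0.
(* The pivot [i0] has exhausted its row and column, so the remaining rows of the factor have no
   entry in column [i0]. *)
have Li0 m : L m i0 = 0.
  have : B1 i0 i0 - \sum_m conjC (L m i0) * L m i0 = 0.
    apply/eqP; rewrite eq_le (psd_diag_ge0 R0) andbT B1i0 sub0r oppr_le0.
    by apply: sumr_ge0 => m' _; rewrite mulrC -normCK exprn_ge0.
  rewrite B1i0 sub0r => /eqP; rewrite oppr_eq0 psumr_eq0; last first.
    by move=> m' _; rewrite mulrC -normCK exprn_ge0.
  move=> /allP /(_ m (mem_index_enum m)) /=.
  by rewrite mulrC -normCK expf_eq0 /= normr_eq0 => /eqP.
have RE i j : B1 i j = \sum_m conjC (L m i) * L m j.
  apply/eqP; rewrite -subr_eq0; apply/eqP.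
  have [->|ii0] := eqVneq i i0; last first.
    by apply: Rs; rewrite mem_rem_uniq ?enum_uniq // !inE ii0 mem_enum.
  by rewrite B1i0 big1 ?subr0 // => m _; rewrite Li0 conjC0 mul0r.
exists (fun m => if m == i0 then l else L m); split.
- move=> i j; rewrite (bigD1 i0) //= eqxx.
  apply/eqP; rewrite addrC -subr_eq; apply/eqP; rewrite -[LHS]/(B1 i j) RE (bigD1 i0) //=.
  rewrite (Ls i0 i0s j) mulr0 add0r.
  by apply: eq_bigr => m /negPf ->.
- by move=> m /negPf ->.
- move=> m j m0; case: eqP => [mk|_].
    by rewrite /l -mk (psd_row0 B0) // mul0r.
  apply: L0; apply/eqP; rewrite eq_le (psd_diag_ge0 B10) andbT /B1 m0 sub0r oppr_le0.
  by rewrite mulrC -normCK exprn_ge0.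
Qed.

End Cholesky.

(** * Operators and bases *)

Section OperatorForms.
Variables (R : realType) (H : vectType R[i]) (dot : {dot H for conjC}).
Local Notation C := R[i].
Local Notation N := (\dim {:H}).
Implicit Types (T X Y P : 'End(H)) (u v w : H).

Lemma opD X u v : X (u + v) = X u + X v.
Proof. exact: linearD. Qed.

Lemma opZ X c u : X (c *: u) = c *: X u.
Proof. exact: linearZ. Qed.

Lemma op_sum X I (r : seq I) (p : pred I) (f : I -> H) :
  X (\sum_(i <- r | p i) f i) = \sum_(i <- r | p i) X (f i).
Proof. exact: linear_sum. Qed.

Lemma dotDl u v w : dot (u + v) w = dot u w + dot v w.
Proof. exact: linearDl. Qed.

Lemma dotZl c u w : dot (c *: u) w = c * dot u w.
Proof. exact: linearZl_LR. Qed.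

Lemma dotDr u v w : dot w (u + v) = dot w u + dot w v.
Proof. exact: linearDr. Qed.

Lemma dotZr c u w : dot w (c *: u) = conjC c * dot w u.
Proof. exact: linearZr_LR. Qed.

Lemma dot0l u : dot 0 u = 0.
Proof. by rewrite -(scale0r (0 : H)) dotZl mul0r. Qed.

Lemma dot0r u : dot u 0 = 0.
Proof. by rewrite -(scale0r (0 : H)) dotZr conjC0 mul0r. Qed.

Lemma dot_suml I (r : seq I) (p : pred I) (f : I -> H) w :
  dot (\sum_(i <- r | p i) f i) w = \sum_(i <- r | p i) dot (f i) w.
Proof. exact: (big_morph (fun x => dot x w) (fun x y => dotDl x y w) (dot0l w)). Qed.

Lemma dot_sumr I (r : seq I) (p : pred I) (f : I -> H) w :
  dot w (\sum_(i <- r | p i) f i) = \sum_(i <- r | p i) dot w (f i).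
Proof. exact: (big_morph (fun x => dot w x) (fun x y => dotDr x y w) (dot0r w)). Qed.

Lemma dot_ge0 u : 0 <= dot u u.
Proof. exact: dnorm_ge0. Qed.

Lemma dot_conj u v : dot v u = conjC (dot u v).
Proof.
exact: (psd_herm dotDl (fun x y z => dotDr x y z) dotZl (fun c x y => dotZr c y x) dot_ge0).
Qed.

Lemma dot_CS u v : `|dot u v| ^+ 2 <= dot u u * dot v v.
Proof.
exact: (psd_CauchySchwarz dotDl (fun x y z => dotDr x y z) dotZl
  (fun c x y => dotZr c y x) dot_ge0).
Qed.

Lemma dot_inj u v : (forall w, dot u w = dot v w) -> u = v.
Proof.
move=> uv; apply/eqP; rewrite -subr_eq0 -(dnorm_eq0 dot).
by rewrite -scaleN1r dotDl dotZl uv mulN1r subrr.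
Qed.

Lemma op_inj X Y : (forall u v, dot (X u) v = dot (Y u) v) -> X = Y.
Proof. by move=> XY; apply/lfunP => u; apply: dot_inj. Qed.

Lemma dot_Ad T X u v : dot (Ad dot T X u) v = dot (X (T u)) (T v).
Proof. by rewrite /Ad !comp_lfunE dot_conj -adjopP -dot_conj. Qed.

Lemma Ad_comp S T X : Ad dot S (Ad dot T X) = Ad dot (T \o S)%VF X.
Proof. by apply: op_inj => u v; rewrite !dot_Ad !comp_lfunE. Qed.

Lemma Ad_id X : Ad dot \1%VF X = X.
Proof. by apply: op_inj => u v; rewrite dot_Ad !id_lfunE. Qed.

Section PositiveOperator.
Variable P : 'End(H).
Hypothesis P0 : pos_op dot P.

Lemma pos_op_CS u v : `|dot (P u) v| ^+ 2 <= dot (P u) u * dot (P v) v.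
Proof.
apply: (@psd_CauchySchwarz _ H +%R *:%R (fun x y => dot (P x) y)) => // *.
- by rewrite opD dotDl.
- exact: dotDr.
- by rewrite opZ dotZl.
- exact: dotZr.
Qed.

Lemma pos_op_conj u v : dot (P v) u = conjC (dot (P u) v).
Proof.
apply: (@psd_herm _ H +%R *:%R (fun x y => dot (P x) y)) => // *.
- by rewrite opD dotDl.
- exact: dotDr.
- by rewrite opZ dotZl.
- exact: dotZr.
Qed.

Lemma pos_op_null u v : dot (P u) u = 0 -> dot (P u) v = 0.
Proof.
move=> u0; have := pos_op_CS u v; rewrite u0 mul0r => h.
by apply/eqP; rewrite -normr_eq0 -sqrf_eq0 eq_le h exprn_ge0.
Qed.

Lemma pos_op_nullr u v : dot (P v) v = 0 -> dot (P u) v = 0.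
Proof. by move=> v0; rewrite pos_op_conj pos_op_null ?conjC0. Qed.

End PositiveOperator.

(** With exactly [N] vectors, spanning means being a basis. *)
Definition spanning (b : 'I_N -> H) := forall v, exists c, v = \sum_i c i *: b i.

(** The bases to come are adapted to [P] rather than orthonormal for [dot], so coordinates are read
    off with a dual family. *)
Definition dual_bases (b d : 'I_N -> H) :=
  (forall i j, dot (b i) (d j) = (i == j)%:R) /\
  forall v, v = \sum_i dot v (d i) *: b i.

Lemma spanning_ex : exists b, spanning b.
Proof.
exists (fun i : 'I_N => (vbasis {:H})`_i) => v.
by exists (coord (vbasis {:H}) ^~ v); apply: coord_vbasis; rewrite memvf.
Qed.

Lemma dual_basis_ex b : spanning b -> exists d, dual_bases b d.
Proof.
move=> sb; pose t := [tuple b i | i < N].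
have tb : basis_of {:H} t.
  rewrite basisEdim size_tuple leqnn andbT; apply/subvP => v _.
  have [c ->] := sb v; apply: memv_suml => i _; apply/memvZ/memv_span.
  by apply/mapP; exists i; rewrite ?mem_enum.
have tE (i : 'I_N) : t`_i = b i by rewrite (nth_map i) ?size_enum_ord // nth_ord_enum.
have /choice[d dE] i : exists w, forall v, coord t i v = dot v w.
  by apply: riesz => c x y; rewrite linearP.
exists d; split=> [i j|v].
  by rewrite -dE -tE coord_free ?(basis_free tb) // eq_sym.
rewrite {1}(coord_basis tb (memvf v)).
by apply: eq_bigr => i _; rewrite dE tE.
Qed.

Section DualBases.
Variables b d : 'I_N -> H.
Hypothesis bd : dual_bases b d.

Lemma op_expand X u v : dot (X u) v =
  \sum_i \sum_j conjC (dot v (d i)) * dot u (d j) * dot (X (b j)) (b i).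
Proof.
rewrite {1}(bd.2 v) dot_sumr; apply: eq_bigr => i _.
rewrite {1}(bd.2 u) op_sum dotZr dot_suml mulr_sumr.
by apply: eq_bigr => j _; rewrite opZ dotZl mulrA.
Qed.

Lemma op_inj_basis X Y : (forall i j, dot (X (b j)) (b i) = dot (Y (b j)) (b i)) -> X = Y.
Proof.
move=> XY; apply: op_inj => u v; rewrite !op_expand.
by apply: eq_bigr => i _; apply: eq_bigr => j _; rewrite XY.
Qed.

Lemma op_of_basis (t : 'I_N -> H) : exists T : 'End(H), forall i, T (b i) = t i.
Proof.
pose f v := \sum_i dot v (d i) *: t i.
have fL : linear f.
  move=> c x y; rewrite /f scaler_sumr -big_split; apply: eq_bigr => i _ /=.
  by rewrite dotDl dotZl scalerDl scalerA.
pose fM := GRing.isLinear.Build _ _ _ _ f fL.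
pose Fl : {linear H -> H} := HB.pack f fM.
exists (linfun Fl) => i; rewrite lfunE /= /f (bigD1 i) //= bd.1 eqxx scale1r.
by rewrite big1 ?addr0 // => j ji; rewrite bd.1 eq_sym (negPf ji) scale0r.
Qed.

Lemma op_of_matrix (m : 'I_N -> 'I_N -> C) :
  exists X : 'End(H), forall i j, dot (X (b j)) (b i) = m i j.
Proof.
have [X XE] := op_of_basis (fun j => \sum_i m i j *: d i).
exists X => i j; rewrite XE dot_suml (bigD1 i) //= dotZl dot_conj bd.1 eqxx conjC1 mulr1.
by rewrite big1 ?addr0 // => k ki; rewrite dotZl dot_conj bd.1 eq_sym (negPf ki) conjC0 mulr0.
Qed.

End DualBases.

(** Gram-Schmidt for the semidefinite form of [P]: [D] marks the vectors that could be normalised,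
    the others being null. The last two clauses remember how vectors arise from [f], in order to
    compare the supports of two operators. *)
Lemma adapted_basis_partial P (f : 'I_N -> H) (s : seq 'I_N) :
  pos_op dot P -> spanning f -> uniq s -> exists g (D : pred 'I_N),
  [/\ spanning g,
      forall i j, i \in s -> dot (P (g j)) (g i) = ((i == j) && D i)%:R,
      forall j, j \notin s -> exists c : 'I_N -> C,
        (forall m, m \notin s -> c m = 0) /\ g j = f j + \sum_m c m *: f m &
      forall i, i \in s -> ~~ D i -> exists c : 'I_N -> C,
        let v := f i + \sum_m c m *: f m in c i = 0 /\ dot (P v) v = 0].
Proof.
move=> P0 sf; elim: s => [|k s IH].
  exists f, pred0; split=> // j _; exists (fun=> 0); split=> //.
  by rewrite big1 ?addr0 // => m _; rewrite scale0r.
move=> /= /andP[ks us]; have [g [D [sg gD gf gn]]] := IH us.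
have [ck [ck0 gk]] := gf k ks.
have gC i j : dot (P (g j)) (g i) = conjC (dot (P (g i)) (g j)) by exact: pos_op_conj.
have sk0 : {in s, forall i, i != k}.
  by move=> i si; apply: contraNneq ks => <-.
have row0 i : i \in s -> dot (P (g i)) (g k) = 0.
  by move=> si; rewrite gC gD // (negPf (sk0 _ si)) conjC0.
have [b0|b0] := eqVneq (dot (P (g k)) (g k)) 0.
  exists g, (fun i => (i != k) && D i); split=> //.
  - move=> i j; rewrite in_cons => /orP[/eqP ->|si].
      by rewrite eqxx andbF pos_op_nullr.
    by rewrite gD // sk0.
  - move=> j; rewrite in_cons negb_or => /andP[jk js].
    have [c [c0 ->]] := gf j js; exists c; split=> // m.
    by rewrite in_cons negb_or => /andP[_]; exact: c0.
  - move=> i; rewrite in_cons => /orP[/eqP -> _|si].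
      by exists ck => /=; rewrite -gk; split=> //; exact: ck0.
    by rewrite sk0 //; exact: gn.
set beta := dot _ _ in b0; have bp : 0 < beta by rewrite lt_neqAle eq_sym b0 P0.
pose r := sqrtC beta; have r0 : r != 0 by rewrite sqrtC_eq0.
have rC : conjC r = r by apply: geC0_conj; rewrite sqrtC_ge0 ltW.
have rr : r * r = beta by rewrite -expr2 sqrtCK.
pose t j := dot (P (g j)) (g k) / beta.
pose g' j := if j == k then r^-1 *: g k else g j - t j *: g k.
have g's j : j \in s -> g' j = g j.
  by move=> sj; rewrite /g' (negPf (sk0 _ sj)) /t row0 // mul0r scale0r subr0.
have tC j : dot (P (g k)) (g j) = conjC (t j) * beta.
  by rewrite gC /t rmorphM fmorphV /= (geC0_conj (ltW bp)) divfK.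
exists g', (fun i => (i == k) || D i); split.
- move=> v; have [c ->] := sg v.
  exists (fun j => if j == k then r * (\sum_(m | m != k) c m * t m + c k) else c j).
  rewrite (bigD1 k) //= [RHS](bigD1 k) //= /g' eqxx scalerA mulrAC mulfV // mul1r.
  rewrite scalerDl [X in _ = X + _]addrC -addrA; congr (_ + _).
  rewrite scaler_suml -big_split /=.
  by apply: eq_bigr => m /negPf mk; rewrite mk scalerBr scalerA addrC subrK.
- move=> i j; rewrite in_cons => /orP[/eqP ->|si].
    rewrite eqxx /= andbT eq_sym /g' eqxx; case: (eqVneq j k) => [_|jk].
      by rewrite opZ dotZl dotZr fmorphV /= rC -/beta -rr mulKf // mulVf.
    rewrite dotZr -scaleNr opD opZ dotDl dotZl -/beta /t mulNr divfK //.
    by rewrite subrr mulr0.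
  rewrite (g's i) // (negPf (sk0 _ si)) /= /g'.
  have gki : dot (P (g k)) (g i) = 0 by rewrite gC row0 // conjC0.
  case: (eqVneq j k) => [->|jk].
    by rewrite opZ dotZl gki mulr0 (negPf (sk0 _ si)).
  by rewrite -scaleNr opD opZ dotDl dotZl gki mulr0 addr0 gD.
- move=> j; rewrite in_cons negb_or => /andP[jk js].
  have [c [c0 cE]] := gf j js.
  exists (fun m => c m - t j * ((m == k)%:R + ck m)); split.
    move=> m; rewrite in_cons negb_or => /andP[/negPf mk ms].
    by rewrite c0 // ck0 // mk addr0 mulr0 subr0.
  rewrite /g' (negPf jk) cE gk -addrA; congr (_ + _).
  have -> : f k + \sum_m ck m *: f m = \sum_m ((m == k)%:R + ck m) *: f m.
    under [RHS]eq_bigr do rewrite scalerDl.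
    rewrite big_split /=; congr (_ + _).
    rewrite (bigD1 k) //= eqxx scale1r big1 ?addr0 // => m /negPf ->.
    by rewrite scale0r.
  rewrite scaler_sumr -sumrB; apply: eq_bigr => m _.
  by rewrite scalerBl scalerA.
- move=> i; rewrite in_cons negb_or; case: (eqVneq i k) => //= _; exact: gn.
Qed.

Lemma adapted_basis P (f : 'I_N -> H) : pos_op dot P -> spanning f ->
  exists g (D : pred 'I_N), [/\ spanning g,
    forall i j, dot (P (g j)) (g i) = ((i == j) && D i)%:R &
    forall i, ~~ D i -> exists c : 'I_N -> C,
      let v := f i + \sum_m c m *: f m in c i = 0 /\ dot (P v) v = 0].
Proof.
move=> P0 sf.
have [g [D [sg gD _ gn]]] := adapted_basis_partial P0 sf (enum_uniq 'I_N).
exists g, D; split=> // [i j|i]; first by rewrite gD // mem_enum.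
by apply: gn; rewrite mem_enum.
Qed.

(** [g] is produced from [f]. If [D1 i] held without [D i], then [f i] plus a combination of the
    other [f m] would be null for [P], hence for [P1]; but those [f m] are [P1]-orthogonal to [f i],
    which has [P1]-length 1. *)
Lemma adapted_bases P1 P : pos_op dot P1 -> (forall u, dot (P1 u) u <= dot (P u) u) ->
  exists f g (D1 D : pred 'I_N), [/\ spanning f /\ spanning g,
    forall i j, dot (P1 (f j)) (f i) = ((i == j) && D1 i)%:R,
    forall i j, dot (P (g j)) (g i) = ((i == j) && D i)%:R &
    forall i, D1 i -> D i].
Proof.
move=> P10 P1P; have P0 : pos_op dot P by move=> u; apply: le_trans (P1P u).
have [b sb] := spanning_ex.
have [f [D1 [sf fD _]]] := adapted_basis P10 sb.
have [g [D [sg gD gn]]] := adapted_basis P0 sf.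
exists f, g, D1, D; split=> // i D1i; apply/negPn/negP => nDi.
have [c [ci v0]] := gn i nDi.
have E : dot (P1 (f i)) (f i) = 1 by rewrite fD eqxx D1i.
set w := \sum_m _ in v0.
have wi : dot (P1 w) (f i) = 0.
  rewrite op_sum dot_suml big1 // => m _; rewrite opZ dotZl fD.
  by case: (eqVneq i m) => [<-|_]; rewrite ?ci ?mul0r ?mulr0.
have : dot (P1 (f i + w)) (f i + w) <= 0 by rewrite -[X in _ <= X]v0.
rewrite opD dotDl !dotDr E wi (pos_op_conj P10 w) wi conjC0 addr0 add0r.
by move=> /(lt_le_trans (ltr_wpDr (P10 w) ltr01)); rewrite ltxx.
Qed.

End OperatorForms.

(** * Completely positive maps as kernels *)

Section KernelCombinations.
Variables (R : realType) (A : unitalCStarType R).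
Local Notation C := R[i].

Lemma poskern_lincomb (I J : Type) (K : finType) (h : J -> K -> I) (c : J -> K -> C)
    (phi : akernel A I) : poskern phi ->
  poskern (fun i j a => \sum_k \sum_l conjC (c i k) * c j l * phi (h i k) (h j l) a).
Proof.
move=> phiP; split=> [i j z a b|s].
  rewrite mulr_sumr -big_split; apply: eq_bigr => k _ /=.
  rewrite mulr_sumr -big_split; apply: eq_bigr => l _ /=.
  by rewrite phiP.1; ring.
pose ex (t : seq (J * A)) :=
  flatten [seq [seq (h p.1 k, c p.1 k *: p.2) | k <- index_enum K] | p <- t].
have := phiP.2 (ex s); congr (0 <= _).
rewrite /kform /ex big_flatten big_map; apply: eq_bigr => p _.
rewrite big_map [RHS]exchange_big; apply: eq_bigr => k _ /=.
rewrite big_flatten big_map; apply: eq_bigr => r _; rewrite big_map.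
apply: eq_bigr => l _ /=; rewrite cstarZ -scalerAl -scalerAr scalerA.
by rewrite (kernZ phiP.1).
Qed.

Lemma poskern_weight (I J : Type) (h : J -> I) (c : J -> C)
    (phi : akernel A I) : poskern phi ->
  poskern (fun i j a => conjC (c i) * c j * phi (h i) (h j) a).
Proof.
move=> phiP; have := poskern_lincomb (K := unit) (fun i _ => h i) (fun i _ => c i) phiP.
congr poskern; apply/funext => i; apply/funext => j; apply/funext => a.
by rewrite !(big_pred1 tt) // => -[].
Qed.

Section Tensor.
Variables (I K : finType) (phi : akernel A I).

(** If [phi] is the kernel of [Phi] at vectors f_i, this is the kernel of [Phi (x) 1] at the vectors
    f_i (x) e_k. *)
Definition tensor_kernel : akernel A (I * K) :=
  fun p q a => (p.2 == q.2)%:R * phi p.1 q.1 a.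

Lemma poskern_tensor : poskern phi -> poskern tensor_kernel.
Proof.
move=> phiP.
have := poskern_sum (fun k : 'I_#|K| => poskern_weight (fst : I * K -> I)
  (fun p => (enum_rank p.2 == k)%:R) phiP).
congr poskern; apply/funext => p; apply/funext => q; apply/funext => a.
rewrite (bigD1 (enum_rank p.2)) //= eqxx conjC1 mul1r big1 ?addr0; last first.
  by move=> k /negPf; rewrite eq_sym => ->; rewrite conjC0 !mul0r.
by rewrite (inj_eq enum_rank_inj) eq_sym.
Qed.

(** The commutant of pi (x) 1 for an irreducible pi, in kernel form. Compressing the second factor
    to a vector [x] gives a kernel below a multiple of [phi], hence a multiple of [phi]; these
    multiples are the values of the quadratic form of [B]. *)
Lemma pure_tensor (theta : akernel A (I * K)) : pure_kernel phi ->
  poskern theta -> poskern (aksub tensor_kernel theta) ->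
  exists2 B, psd_mx B & forall i j k l a, theta (i, k) (j, l) a = B k l * phi i j a.
Proof.
move=> [phiP [i0 i01] pure] thP le.
pose B k l := theta (i0, k) (i0, l) 1 / phi i0 i0 1.
pose tx (x : K -> C) : akernel A I :=
  fun i j a => \sum_k \sum_l conjC (x k) * x l * theta (i, k) (j, l) a.
have txE (x : K -> C) : exists2 c : R, 0 <= c & tx x = akscale c%:C phi.
  pose M := complex.Re (\sum_k conjC (x k) * x k).
  have ME : M%:C = \sum_k conjC (x k) * x k.
    by apply: RRe_real; apply: ger0_real; apply: sumr_ge0 => k _; rewrite mulrC -normCK exprn_ge0.
  apply: (pure M).
  - rewrite -(lecR 0) ME; apply: sumr_ge0 => k _; by rewrite mulrC -normCK exprn_ge0.
  - exact: (poskern_lincomb (fun i k => (i, k)) (fun _ k => x k) thP).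
  - have := poskern_lincomb (fun i k => (i, k)) (fun _ k => x k) le.
    congr poskern; apply/funext => i; apply/funext => j; apply/funext => a.
    rewrite /aksub /akscale /tx ME mulr_suml -sumrB; apply: eq_bigr => k _.
    have -> : conjC (x k) * x k * phi i j a =
        \sum_l conjC (x k) * x l * ((k == l)%:R * phi i j a).
      rewrite (bigD1 k) //= eqxx mul1r big1 ?addr0 // => l /negPf.
      by rewrite eq_sym => ->; rewrite mul0r mulr0.
    by rewrite -sumrB; apply: eq_bigr => l _; rewrite -mulrBr.
have BE (x : K -> C) : exists2 c : R, 0 <= c & tx x = akscale c%:C phi /\ mxform B x x = c%:C.
  have [c c0 h] := txE x; exists c => //; split=> //.
  have /(congr1 (fun f => f i0 i0 1 / phi i0 i0 1)) := h.
  rewrite /akscale mulfK // => <-; rewrite /mxform mulr_suml; apply: eq_bigr => k _.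
  by rewrite mulr_suml; apply: eq_bigr => l _; rewrite /B mulrA.
exists B => [x|i j k l a].
  by have [c c0 [_ ->]] := BE x; rewrite (lecR 0).
(* Equality of entries follows by polarisation, since the quadratic form of [G] vanishes. *)
pose G k l := theta (i, k) (j, l) a - B k l * phi i j a.
have G0 x : mxform G x x = 0.
  have [c c0 [h h']] := BE x.
  have /(congr1 (fun f => f i j a)) := h; rewrite /akscale -h' /tx => /eqP.
  rewrite -subr_eq0 => /eqP <-; rewrite /mxform mulr_suml -sumrB; apply: eq_bigr => m _.
  rewrite mulr_suml -sumrB; apply: eq_bigr => p _; rewrite /G; ring.
have Gp : psd_mx G by move=> x; rewrite G0.
apply/eqP; rewrite -subr_eq0; apply/eqP; apply: (psd_row0 Gp).
by rewrite -[LHS](mxform_delta2 G) G0.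
Qed.

End Tensor.
End KernelCombinations.

Section CPKernels.
Variables (R : realType) (A : unitalCStarType R).
Variables (H : vectType R[i]) (dot : {dot H for conjC}).
Local Notation C := R[i].
Local Notation N := (\dim {:H}).
Implicit Types (Phi Psi : A -> 'End(H)) (P S T X : 'End(H)).

Definition opkern Phi : akernel A H := fun u v a => dot (Phi a v) u.
Definition bkern (b : 'I_N -> H) Phi : akernel A 'I_N :=
  fun i j a => dot (Phi a (b j)) (b i).

Lemma CP_poskern Phi : CP dot Phi -> poskern (opkern Phi).
Proof.
move=> [PhiL PhiP]; split=> [u v c a b|s].
  by rewrite /opkern PhiL add_lfunE scale_lfunE dotDl dotZl.
case Es: s => [|p0 s']; first by rewrite /kform big_nil.
rewrite -Es; have sz : size s = (size s').+1 by rewrite Es.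
pose k := (size s').+1; pose x (i : 'I_k) := nth p0 s i.
(* Only the first row of [Y] is nonzero, so [mxstar Y *m Y] has the entries [cstar a_i * a_j]; the
   empty [s] was set aside so that this row exists. *)
pose Y : 'M[A]_k := \matrix_(i, j) if i == ord0 then (x j).2 else 0.
have := PhiP k (mxstar Y *m Y) (ex_intro _ Y erefl) (fun i => (x i).1).
congr (0 <= _); rewrite /kform (big_nth p0) sz big_mkord; apply: eq_bigr => i _.
rewrite (big_nth p0) sz big_mkord; apply: eq_bigr => j _.
rewrite /opkern mxE big_ord_recl !mxE eqxx big1 ?addr0 // => l _.
by rewrite !mxE /= mulr0.
Qed.

Lemma poskern_CP Phi : poskern (opkern Phi) -> CP dot Phi.
Proof.
move=> PhiP; have PhiL : linear Phi.
  move=> c a b; apply: (@op_inj _ _ dot) => u v.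
  by rewrite add_lfunE scale_lfunE dotDl dotZl; exact: PhiP.1.
split=> // k X [Y ->] h.
(* Conversely, each row [l] of [Y] contributes one value of the form. *)
have -> : \sum_i \sum_j dot (Phi ((mxstar Y *m Y) i j) (h j)) (h i) =
    \sum_l kform (opkern Phi) [seq (h i, Y l i) | i <- index_enum 'I_k]
                              [seq (h i, Y l i) | i <- index_enum 'I_k].
  rewrite /kform [RHS](eq_bigr (fun l =>
    \sum_i \sum_j opkern Phi (h i) (h j) (cstar (Y l i) * Y l j))).
    rewrite [RHS]exchange_big; apply: eq_bigr => i _.
    rewrite [RHS]exchange_big; apply: eq_bigr => j _.
    rewrite mxE -[LHS]/(opkern Phi (h i) (h j) _).
    rewrite (big_morph _ (kernD PhiP.1 _ _) (kern0 PhiP.1 _ _)).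
    by apply: eq_bigr => l _; rewrite mxE.
  by move=> l _; rewrite big_map; apply: eq_bigr => i _; rewrite big_map.
by apply: sumr_ge0 => l _; exact: PhiP.2.
Qed.

Lemma CP_Ad T Phi : CP dot Phi -> CP dot (fun a => Ad dot T (Phi a)).
Proof.
move=> /CP_poskern PhiP; apply: poskern_CP.
have := poskern_pull T PhiP; congr poskern.
by apply/funext => u; apply/funext => v; apply/funext => a; rewrite /opkern dot_Ad.
Qed.

Lemma CP_sum n (Phi : 'I_n -> A -> 'End(H)) : (forall k, CP dot (Phi k)) ->
  CP dot (fun a => \sum_k Phi k a).
Proof.
move=> PhiP; apply: poskern_CP.
have := poskern_sum (fun k => CP_poskern (PhiP k)); congr poskern.
apply/funext => u; apply/funext => v; apply/funext => a.
by rewrite /opkern sum_lfunE dot_suml.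
Qed.

Lemma CP_pos_op Phi : CP dot Phi -> pos_op dot (Phi 1).
Proof. by move=> /CP_poskern PhiP u; exact: (kern_diag_ge0 PhiP). Qed.

Lemma CP_null Phi a u v : CP dot Phi -> dot (Phi 1 u) u = 0 \/ dot (Phi 1 v) v = 0 ->
  dot (Phi a v) u = 0.
Proof. by move=> /CP_poskern PhiP uv; exact: (kern_null PhiP). Qed.

Section Basis.
Variables b d : 'I_N -> H.
Hypothesis bd : dual_bases dot b d.

Lemma CP_bkern Phi : CP dot Phi <-> poskern (bkern b Phi).
Proof.
split=> [/CP_poskern PhiP|PhiP]; first exact: (poskern_pull b PhiP).
apply: poskern_CP.
have := poskern_lincomb (fun (u : H) i => i) (fun u i => dot u (d i)) PhiP.
congr poskern; apply/funext => u; apply/funext => v; apply/funext => a.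
by rewrite /opkern (op_expand bd).
Qed.

Lemma bkern_inj Phi Psi : bkern b Phi = bkern b Psi -> Phi = Psi.
Proof.
move=> E; apply/funext => a; apply: (op_inj_basis bd) => i j.
by have /(congr1 (fun f => f i j a)) := E.
Qed.

Lemma CP_of_kernel (phi : akernel A 'I_N) : poskern phi ->
  exists2 Phi, CP dot Phi & bkern b Phi = phi.
Proof.
move=> phiP; have /choice[Phi PhiE] a := op_of_matrix bd (fun i j => phi i j a).
have E : bkern b Phi = phi.
  by apply/funext => i; apply/funext => j; apply/funext => a; exact: PhiE.
by exists Phi => //; apply/CP_bkern; rewrite E.
Qed.

End Basis.

(** The decomposition takes place in an arbitrary basis, whereas the extension of each pure map
    needs a basis adapted to its value at [1]. *)
Lemma pure_basis (b d b' d' : 'I_N -> H) Phi : dual_bases dot b d -> dual_bases dot b' d' ->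
  pure_kernel (bkern b Phi) -> pure_kernel (bkern b' Phi).
Proof.
move=> bd bd' [PhiP [i i1] pure].
have Phicp := (CP_bkern bd Phi).2 PhiP.
have PhiP' := (CP_bkern bd' Phi).1 Phicp.
split=> //.
  apply: poskern_nonzero => // Phi0; move: i1; have -> : bkern b Phi = fun _ _ _ => 0.
    have E : Phi = fun=> 0.
      apply: (bkern_inj bd'); rewrite Phi0.
      by apply/funext => k; apply/funext => j; apply/funext => a; rewrite /bkern lfunE dot0l.
    by apply/funext => k; apply/funext => j; apply/funext => a; rewrite /bkern E lfunE dot0l.
  by rewrite eqxx.
move=> M theta M0 thP le.
have [Th Thcp ThE] := CP_of_kernel bd' thP.
have [|c c0 E] := pure M (bkern b Th) M0 ((CP_bkern bd Th).1 Thcp).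
  pose D a := M%:C *: Phi a - Th a.
  have DE b0 : bkern b0 D = aksub (akscale M%:C (bkern b0 Phi)) (bkern b0 Th).
    apply/funext => k; apply/funext => j; apply/funext => a.
    by rewrite /bkern /D add_lfunE opp_lfunE scale_lfunE dotDl dotZl -scaleN1r dotZl mulN1r.
  by rewrite -DE; apply/(CP_bkern bd)/(CP_bkern bd'); rewrite DE ThE.
exists c => //; rewrite -ThE.
have -> : Th = fun a => c%:C *: Phi a.
  apply: (bkern_inj bd); rewrite E; apply/funext => k; apply/funext => j; apply/funext => a.
  by rewrite /bkern scale_lfunE dotZl.
by apply/funext => k; apply/funext => j; apply/funext => a; rewrite /bkern scale_lfunE dotZl.
Qed.

End CPKernels.

(** * C*-extreme points *)

Section ExtremePoints.
Variables (R : realType) (A : unitalCStarType R).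
Variables (H : vectType R[i]) (dot : {dot H for conjC}).
Local Notation C := R[i].
Local Notation N := (\dim {:H}).
Implicit Types (Phi Psi : A -> 'End(H)) (P S T X : 'End(H)).

(** [S] preserves the seminorm of [P], so it is injective modulo null vectors, but it may be
    singular on the null space. [S'] drops the null components of [S (g i)] for [D i] and is the
    identity on the null basis vectors. *)
Lemma invertible_correction (g d : 'I_N -> H) (D : pred 'I_N) P S :
  dual_bases dot g d -> pos_op dot P ->
  (forall i j, dot (P (g j)) (g i) = ((i == j) && D i)%:R) ->
  Ad dot S P = P ->
  exists2 S', invertible_op S' & forall v, dot (P (S v - S' v)) (S v - S' v) = 0.
Proof.
move=> gd P0 gD SP.
have SE u v : dot (P (S u)) (S v) = dot (P u) v by rewrite -dot_Ad SP.
have gnull i : ~~ D i -> dot (P (g i)) (g i) = 0.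
  by move=> /negPf Di; rewrite gD Di andbF.
pose t i := if D i then \sum_k ((D k)%:R * dot (S (g i)) (d k)) *: g k else g i.
have [S' S'E] := op_of_basis gd t.
have wi i u : dot (P (S (g i) - S' (g i))) u = 0.
  rewrite S'E /t; case: (boolP (D i)) => Di.
    rewrite {1}(gd.2 (S (g i))) -sumrB op_sum dot_suml big1 // => k _.
    rewrite -scalerBl opZ dotZl; case: (boolP (D k)) => Dk.
      by rewrite mul1r subrr mul0r.
    by rewrite (pos_op_null P0) ?mulr0 // gnull.
  rewrite -scaleN1r opD opZ dotDl dotZl (pos_op_null P0) ?add0r; last first.
    by rewrite SE gnull.
  by rewrite (pos_op_null P0) ?mulr0 // gnull.
have wv v u : dot (P (S v - S' v)) u = 0.
  have -> : S v - S' v = \sum_i dot v (d i) *: (S (g i) - S' (g i)).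
    rewrite {1 2}(gd.2 v) !op_sum -sumrB; apply: eq_bigr => i _.
    by rewrite !opZ scalerBr.
  by rewrite op_sum dot_suml big1 // => i _; rewrite opZ dotZl wi mulr0.
exists S'; last by move=> v; exact: wv.
(* If [S' v = 0], then [S v] and hence [v] are null for [P], so [v] has no coordinate in [D]; there
   [S'] is the identity. *)
have S'0 v : S' v = 0 -> v = 0.
  move=> S'v; have Pv u : dot (P v) u = 0.
    apply: (pos_op_null P0); rewrite -SE.
    by have := wv v (S v); rewrite S'v subr0.
  have Dv i : D i -> dot v (d i) = 0.
    move=> Di; have := Pv (g i); rewrite {1}(gd.2 v) op_sum dot_suml (bigD1 i) //=.
    rewrite opZ dotZl gD eqxx Di mulr1 big1 ?addr0 // => j /negPf ji.
    by rewrite opZ dotZl gD eq_sym ji mulr0.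
  rewrite -S'v {2}(gd.2 v) op_sum [LHS](gd.2 v); apply: eq_bigr => i _.
  rewrite opZ S'E /t; case: (boolP (D i)) => // Di.
  by rewrite Dv // !scale0r.
have ker0 : lker S' == 0%VS.
  apply/lker0P => u v uv; apply/eqP; rewrite -subr_eq0; apply/eqP/S'0.
  by rewrite -scaleN1r opD opZ scaleN1r uv subrr.
by exists (S'^-1)%VF; rewrite lker0_compVf // lker0_compfV.
Qed.

Lemma CP_Ad_null P Phi S S' : CP dot Phi -> Phi 1 = P ->
  (forall v, dot (P (S v - S' v)) (S v - S' v) = 0) ->
  forall a, Ad dot S (Phi a) = Ad dot S' (Phi a).
Proof.
move=> Phicp Phi1 w a; apply: (@op_inj _ _ dot) => u v; rewrite !dot_Ad.
have w0 x y : dot (Phi a (S x - S' x)) y = 0 /\ dot (Phi a y) (S x - S' x) = 0.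
  by split; apply: (CP_null _ Phicp); rewrite Phi1 w; auto.
rewrite -[S u](subrK (S' u)) opD dotDl (w0 u _).1 add0r.
by rewrite -[S v](subrK (S' v)) dotDr (w0 v _).2 add0r.
Qed.

(** * Extension of one pure map to a C*-extreme point *)

Section PureMap.
Variables (P : 'End(H)) (Phi1 : A -> 'End(H)).
Variables (f df g dg : 'I_N -> H) (D1 D : pred 'I_N) (i0 : 'I_N).
Hypothesis P0 : pos_op dot P.
Hypothesis Phi1cp : CP dot Phi1.
Hypothesis fdf : dual_bases dot f df.
Hypothesis gdg : dual_bases dot g dg.
Hypothesis fD : forall i j, dot (Phi1 1 (f j)) (f i) = ((i == j) && D1 i)%:R.
Hypothesis gD : forall i j, dot (P (g j)) (g i) = ((i == j) && D i)%:R.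
Hypothesis D1D : forall i, D1 i -> D i.
Hypothesis D1i0 : D1 i0.
Hypothesis phi_pure : pure_kernel (bkern dot f Phi1).

Let phi := bkern dot f Phi1.
Let phiP : poskern phi. Proof. by case: phi_pure. Qed.
(** Together, [iota] and [kap] match [g i] with f_i (x) e_i0 when [D1 i], and with f_i0 (x) e_i
    otherwise. These vectors are distinct because [D1 i0] holds. *)
Let iota i := if D1 i then i else i0.
Let kap i := if D1 i then i0 else i.
Let omega : akernel A ('I_N * 'I_N)%type := tensor_kernel phi.
Let omegaP : poskern omega := poskern_tensor 'I_N phiP.
Let jm i := (iota i, kap i).

(* The pure map [Phi1], extended to the whole support of [P] by copies of the
   vector state of [Phi1] at [f i0]. *)
Let psi : akernel A 'I_N := fun i j a => (D i)%:R * (D j)%:R * omega (jm i) (jm j) a.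

Let jm_inj : injective jm.
Proof.
move=> i j; rewrite /jm /iota /kap => -[].
case: (boolP (D1 i)) => Di; case: (boolP (D1 j)) => Dj // _ ij.
- by move: Dj; rewrite -ij D1i0.
- by move: Di; rewrite ij D1i0.
Qed.

Let psiP : poskern psi.
Proof.
have := poskern_weight jm (fun i => (D i)%:R) omegaP; congr poskern.
by apply/funext => i; apply/funext => j; apply/funext => a; rewrite conjC_nat.
Qed.

Let psi1 i j : psi i j 1 = ((i == j) && D i)%:R.
Proof.
rewrite /psi /omega /tensor_kernel /phi /bkern /= fD.
have -> : D1 (iota i) by rewrite /iota; case: ifP.
have [<-|ij] := eqVneq i j.
  by rewrite !eqxx /= !mulr1; case: (D i); rewrite ?mulr0 ?mulr1.
have : jm i != jm j by rewrite (inj_eq jm_inj).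
rewrite xpair_eqE andbT => /=.
by case: (iota i == _); case: (kap i == _) => //=; rewrite ?mulr0 ?mul0r ?mulr0.
Qed.

(** The second tensor indices that occur in the compression. *)
Let Mset : pred 'I_N := fun k => (k == i0) || D k && ~~ D1 k.

Let kapM i : D i -> Mset (kap i).
Proof.
by move=> Di; rewrite /Mset /kap; case: (boolP (D1 i)) => D1i; rewrite ?eqxx // Di D1i orbT.
Qed.

(** The index whose vector is f_(iota i) (x) e_m; when [D1 i], it exists only for m = i0 in general,
    whence the last hypothesis of [tauP]. *)
Let tau i m := if D1 i then i else m.

Let tauP i m : D i -> Mset m -> (D1 i -> m = i0) ->
  [/\ D (tau i m), iota (tau i m) = iota i & kap (tau i m) = m].
Proof.
move=> Di Mm mi; rewrite /tau /iota /kap; case: (boolP (D1 i)) => [D1i|nD1i].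
  by rewrite D1i mi.
move: Mm; rewrite /Mset => /orP[/eqP ->|/andP[Dm /negPf D1m]].
  by rewrite D1i0; split=> //; exact: D1D.
by rewrite D1m.
Qed.

(* Every kernel below [psi] comes from an operator: a Cholesky factor of its
   coefficient matrix, pivoted so that the copies are only mixed among
   themselves and with [i0]. *)
Lemma below_pure_extension Psi (theta : akernel A 'I_N) :
  bkern dot g Psi = psi -> poskern theta -> poskern (aksub psi theta) ->
  exists S, bkern dot g (fun a => Ad dot S (Psi a)) = theta.
Proof.
move=> PsiE thP le.
(* On [D] the weights in [psi] are 1, so [psi] is there a pullback of [omega] and the lifting
   applies. *)
pose J0 := {i : 'I_N | D i}.
have j_inj : injective (fun i : J0 => jm (val i)) by move=> i j /jm_inj /val_inj.
have thP0 : poskern (fun i j : J0 => theta (val i) (val j)) by exact: poskern_pull.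
have [|th' [th'P th'le th'E]] := kernel_lifting j_inj omegaP thP0.
  have := poskern_pull (val : J0 -> 'I_N) le; congr poskern.
  apply/funext => i; apply/funext => j; apply/funext => a.
  by rewrite /aksub /psi !(valP i, valP j) !mul1r.
have [B B0 BE] := pure_tensor phi_pure th'P th'le.
(* Truncating to [Mset] makes the other rows of [L] vanish, so that every nonzero coefficient refers
   to a vector of the compression. *)
pose B' k l := if Mset k && Mset l then B k l else 0.
have B'0 : psd_mx B'.
  move=> x; have := B0 (fun k => if Mset k then x k else 0); congr (0 <= _).
  apply: eq_bigr => k _; apply: eq_bigr => l _; rewrite /B'.
  by case: (Mset k); case: (Mset l) => /=; rewrite ?conjC0 ?mul0r ?mulr0 ?mul0r.
have [L [LE Li0 L0]] := cholesky i0 B'0.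
have LM m j : L m j != 0 -> Mset m.
  by apply: contraNT => /negPf Mm; apply/eqP/L0; rewrite /B' Mm.
pose c i m := if D i then L m (kap i) else 0.
(* On the indices of [D], [S] is 1 (x) L read in the basis [g]. *)
have [S SE] := op_of_basis gdg (fun i => \sum_m c i m *: g (tau i m)).
exists S; apply/funext => i; apply/funext => j; apply/funext => a.
have psiE k l : dot (Psi a (g l)) (g k) = psi k l a by rewrite -PsiE.
have -> : bkern dot g (fun a => Ad dot S (Psi a)) i j a =
    \sum_m \sum_m' conjC (c i m) * c j m' * psi (tau i m) (tau j m') a.
  rewrite /bkern dot_Ad !SE dot_sumr; apply: eq_bigr => m _.
  rewrite dotZr op_sum dot_suml mulr_sumr; apply: eq_bigr => m' _.
  by rewrite opZ dotZl psiE mulrA.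
have th0 k : ~~ D k -> theta k k 1 = 0.
  move=> /negPf Dk; apply/eqP; rewrite eq_le (kern_diag_ge0 thP) andbT.
  have := kern_diag_ge0 le k; rewrite /aksub psi1 Dk andbF sub0r.
  by rewrite oppr_ge0.
case: (boolP (D i)) => Di; last first.
  have -> : theta i j a = 0 by apply: (kern_null thP); left; exact: th0.
  rewrite big1 // => m _; rewrite big1 // => m' _.
  by rewrite /c (negPf Di) conjC0 !mul0r.
case: (boolP (D j)) => Dj; last first.
  have -> : theta i j a = 0 by apply: (kern_null thP); right; exact: th0.
  rewrite big1 // => m _; rewrite big1 // => m' _.
  by rewrite /c (negPf Dj) mulr0 !mul0r.
have := th'E (Sub i Di) (Sub j Dj) a; rewrite !SubK => <-.
rewrite [th' _ _ _]BE.
have <- : B' (kap i) (kap j) = B (kap i) (kap j) by rewrite /B' !kapM.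
rewrite LE mulr_suml; apply: eq_bigr => m _.
have key m' : conjC (c i m) * c j m' * psi (tau i m) (tau j m') a =
    (m == m')%:R * (conjC (L m (kap i)) * L m' (kap j) * phi (iota i) (iota j) a).
  rewrite /c Di Dj.
  have [->|Li] := eqVneq (L m (kap i)) 0; first by rewrite conjC0 !(mul0r, mulr0).
  have [->|Lj] := eqVneq (L m' (kap j)) 0; first by rewrite !(mul0r, mulr0).
  have pe k l : L l (kap k) != 0 -> D1 k -> l = i0.
    move=> Ll D1k; apply/eqP; apply: contraNT Ll => li.
    by rewrite /kap D1k Li0.
  have [Dm im km] := tauP Di (LM _ _ Li) (pe _ _ Li).
  have [Dm' jm' km'] := tauP Dj (LM _ _ Lj) (pe _ _ Lj).
  by rewrite /psi /omega /tensor_kernel Dm Dm' /= im jm' km km' !mul1r mulrCA.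
under eq_bigr do rewrite key.
by rewrite (eq_bigr (fun m' => (m' == m)%:R * (conjC (L m (kap i)) * L m' (kap j) *
  phi (iota i) (iota j) a))) ?sum_delta // => m' _; rewrite eq_sym.
Qed.

(** Each summand is below [Psi], hence of the form [Ad S] of [Psi]; undoing [T k] leaves an operator
    that preserves [P], which is then corrected to an invertible one. *)
Lemma pure_extension_extreme Psi : CP dot Psi -> bkern dot g Psi = psi ->
  Cstar_extreme dot P Psi.
Proof.
move=> Psicp PsiE.
have Psi1 : Psi 1 = P.
  apply: (op_inj_basis gdg) => i j; rewrite gD -psi1.
  by have /(congr1 (fun h => h i j 1)) := PsiE.
split=> // n T Phi n0 PhiP Tinv Tc PsiS.
suff /choice[S SP] k : exists S, invertible_op S /\ Phi k = (fun a => Ad dot S (Psi a)).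
  by exists S.
have cpk l : CP dot (fun a => Ad dot (T l) (Phi l a)) by apply: CP_Ad; exact: (PhiP l).1.
have [|S SE] := @below_pure_extension Psi (bkern dot g (fun a => Ad dot (T k) (Phi k a))) PsiE
    ((CP_bkern gdg _).1 (cpk k)).
  have rest : forall l : 'I_n, poskern (fun i j a =>
      if l == k then 0 else bkern dot g (fun a => Ad dot (T l) (Phi l a)) i j a).
    move=> l; case: (l == k); first exact: poskern0.
    exact: (CP_bkern gdg _).1 (cpk l).
  have := poskern_sum rest; congr poskern.
  apply/funext => i; apply/funext => j; apply/funext => a.
  rewrite /aksub -PsiE PsiS /bkern /Cstar_sum sum_lfunE dot_suml (bigD1 k) //= eqxx add0r.
  rewrite [in RHS](bigD1 k) //= addrAC subrr add0r.
  by apply: eq_bigr => l /negPf ->.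
have {}SE := bkern_inj gdg SE.
have [V [VT TV]] := Tinv k.
have PhiE a : Phi k a = Ad dot (S \o V)%VF (Psi a).
  have /(congr1 (fun h => h a)) /= := SE; rewrite -Ad_comp => ->.
  by rewrite Ad_comp TV Ad_id.
have SVP : Ad dot (S \o V)%VF P = P by rewrite -{1}Psi1 -PhiE (PhiP k).2.
have [S' S'inv S'E] := invertible_correction gdg P0 gD SVP.
exists S'; split=> //; apply/funext => a.
by rewrite PhiE; exact: (CP_Ad_null Psicp Psi1 S'E).
Qed.

Lemma pure_map_compression : exists T Psi, [/\ Cstar_extreme dot P Psi,
  forall a, Phi1 a = Ad dot T (Psi a) & Ad dot T P = Phi1 1].
Proof.
have [Psi Psicp PsiE] := CP_of_kernel gdg psiP.
have Psiext := pure_extension_extreme Psicp PsiE.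
have [T TE] := op_of_basis fdf (fun i => if D1 i then g i else 0).
have E a : Phi1 a = Ad dot T (Psi a).
  apply: (op_inj_basis fdf) => i j; rewrite dot_Ad !TE.
  have n0 k : ~~ D1 k -> dot (Phi1 1 (f k)) (f k) = 0.
    by move=> /negPf Dk; rewrite fD Dk andbF.
  case: (boolP (D1 j)) => Dj; last first.
    by rewrite linear0 dot0l; apply: (CP_null _ Phi1cp); right; exact: n0.
  case: (boolP (D1 i)) => Di; last first.
    by rewrite dot0r; apply: (CP_null _ Phi1cp); left; exact: n0.
  have -> : dot (Psi a (g j)) (g i) = psi i j a by rewrite -PsiE.
  rewrite /psi /omega /tensor_kernel /= /kap /iota Di Dj eqxx !D1D //.
  by rewrite !mul1r.
by exists T, Psi; split=> //; rewrite E Psiext.1.2.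
Qed.

End PureMap.
End ExtremePoints.

(** * Density *)

Section Density.
Variables (R : realType) (A : unitalCStarType R).
Variables (H : vectType R[i]) (dot : {dot H for conjC}).
Local Notation C := R[i].
Local Notation N := (\dim {:H}).
Variable P : 'End(H).
Hypothesis P0 : pos_op dot P.
Implicit Types (Phi Psi : A -> 'End(H)).

Lemma pure_in_hull Phi b d : dual_bases dot b d -> CP dot Phi -> pure_kernel (bkern dot b Phi) ->
  (forall u, dot (Phi 1 u) u <= dot (P u) u) ->
  exists T Psi, [/\ Cstar_extreme dot P Psi,
    forall a, Phi a = Ad dot T (Psi a) & Ad dot T P = Phi 1].
Proof.
move=> bd Phicp pure le.
have [f [g [D1 [D [[sf sg] fD gD D1D]]]]] := adapted_bases (CP_pos_op Phicp) le.
have [df fdf] := dual_basis_ex dot sf; have [dg gdg] := dual_basis_ex dot sg.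
have puref := pure_basis bd fdf pure.
have [i0 D1i0] : exists i, D1 i.
  have [_ [i + _]] := puref; rewrite /bkern fD eqxx.
  by case: (boolP (D1 i)) => [Di _|_]; [exists i | rewrite eqxx].
exact: (pure_map_compression P0 Phicp fdf gdg fD gD D1D D1i0 puref).
Qed.

(** Serves the empty decomposition: it forces [P = 0], while the hull asks for at least one
    summand. *)
Lemma zero_extreme : P = 0 -> Cstar_extreme dot P (fun _ : A => 0).
Proof.
move=> Pe.
have z Phi : CPP dot P Phi -> Phi = fun=> 0.
  move=> [Phicp Phi1]; apply/funext => a; apply: (@op_inj _ _ dot) => u v.
  rewrite lfunE dot0l; apply: (CP_null _ Phicp); left.
  by rewrite Phi1 Pe lfunE dot0l.
have zP : CPP dot P (fun _ : A => 0).
  split=> //; apply: poskern_CP; have := poskern0 A H; congr poskern.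
  by apply/funext => u; apply/funext => v; apply/funext => a; rewrite /opkern lfunE dot0l.
split=> // n T Phi n0 PhiP _ _ _; exists (fun=> \1%VF) => j; split.
  by exists \1%VF; rewrite comp_lfun1l.
by rewrite (z _ (PhiP j)); apply/funext => a; rewrite Ad_id.
Qed.

Lemma hull_agrees Phi (s : seq A) : CPP dot P Phi -> exists Psi,
  [/\ Cstar_hull dot P (Cstar_extreme dot P) Psi, CPP dot P Psi &
      forall a, a \in s -> Psi a = Phi a].
Proof.
move=> [Phicp Phi1]; have [b sb] := spanning_ex H; have [d bd] := dual_basis_ex dot sb.
(* With [1] added to [s], the pure summands have values at [1] adding up to exactly [P]; each is
   thus below [P], and the coefficients satisfy the hull condition. *)
have [|phi [n [chi [chiP phiE]]] phis] :=
  pure_approximation (s := 1 :: s) ((CP_bkern bd Phi).1 Phicp); first exact: mem_head.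
have /choice[Phik PhikP] k : exists Psi, CP dot Psi /\ bkern dot b Psi = chi k.
  have [chik _ _] := chiP k.
  by have [Psi ? ?] := CP_of_kernel bd chik; exists Psi.
pose Psi a := \sum_k Phik k a.
have Psicp : CP dot Psi by apply: CP_sum => k; exact: (PhikP k).1.
have Psis a : a \in 1 :: s -> Psi a = Phi a.
  move=> sa; apply: (op_inj_basis bd) => i j.
  rewrite -[RHS]/(bkern dot b Phi i j a) -phis // phiE /Psi sum_lfunE dot_suml.
  by apply: eq_bigr => k _; rewrite -(PhikP k).2.
have Psi1 : Psi 1 = P by rewrite Psis ?mem_head.
exists Psi; split=> //; last by move=> a sa; rewrite Psis // in_cons sa orbT.
have [n0|n0] := posnP n.
  subst n; have Pe : P = 0 by rewrite -Psi1 /Psi big_ord0.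
  exists 1, (fun=> \1%VF), (fun _ _ => 0); split=> //.
  - by move=> _; exact: zero_extreme.
  - by rewrite /Cstar_coeffs big_ord1 Ad_id.
  - by apply/funext => a; rewrite /Psi big_ord0 /Cstar_sum big_ord1 Ad_id.
have /choice[TP TPP] k : exists z : 'End(H) * (A -> 'End(H)),
    [/\ Cstar_extreme dot P z.2, forall a, Phik k a = Ad dot z.1 (z.2 a) &
        Ad dot z.1 P = Phik k 1].
  have [|u|T [Z TZ]] := @pure_in_hull (Phik k) b d bd (PhikP k).1; last by exists (T, Z).
    by rewrite (PhikP k).2.
  rewrite -Psi1 /Psi sum_lfunE dot_suml (bigD1 k) //= lerDl.
  by apply: sumr_ge0 => l _; exact: (CP_pos_op (PhikP l).1).
exists n, (fun k => (TP k).1), (fun k => (TP k).2); split=> //.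
- by move=> k; have [] := TPP k.
- rewrite /Cstar_coeffs -[RHS]Psi1; apply: eq_bigr => k _.
  by have [_ _ ->] := TPP k.
- apply/funext => a; apply: eq_bigr => k _.
  by have [_ E _] := TPP k; exact: E.
Qed.

(** In a [P]-adapted basis, [dot (P u) u] is a sum of squares of some of the coordinates
    [dot u (d i)], and Cauchy-Schwarz bounds each. *)
Lemma pos_op_bound : exists2 p : R, 0 <= p & forall u, dot (P u) u <= p%:C * dot u u.
Proof.
have [b sb] := spanning_ex H; have [g [D [sg gD _]]] := adapted_basis P0 sb.
have [d gd] := dual_basis_ex dot sg.
pose S := \sum_i dot (d i) (d i).
have S0 : 0 <= S by apply: sumr_ge0 => i _; exact: dot_ge0.
have SE : (complex.Re S)%:C = S by apply: RRe_real; exact: ger0_real.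
exists (complex.Re S) => [|u]; first by rewrite -(lecR 0) SE.
rewrite SE /S mulr_suml (op_expand gd); apply: ler_sum => i _.
rewrite (bigD1 i) //= big1 ?addr0; last first.
  by move=> j /negPf ji; rewrite gD eq_sym ji mulr0.
rewrite gD eqxx /=; apply: le_trans (_ : `|dot u (d i)| ^+ 2 <= _).
  rewrite [conjC _ * _]mulrC -normCK.
  by case: (D i); rewrite ?mulr1 // mulr0 exprn_ge0.
by rewrite [dot (d i) _ * _]mulrC dot_CS.
Qed.

Lemma CPP_bounded : exists2 M : R, 0 <= M & forall Phi, CPP dot P Phi -> bounded_by dot M Phi.
Proof.
(* With k = Phi a h, [kern_bound] gives |k|^4 <= 2 |a|^2 p^2 |k|^2 |h|^2, and 2 p exceeds the
   resulting constant. *)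
have [p p0 pP] := pos_op_bound; exists (2 * p); first exact: mulr_ge0.
move=> Phi [/CP_poskern PhiP Phi1]; split; first exact: mulr_ge0.
move=> a h; set k := Phi a h.
have RE u : exists2 x : R, 0 <= x & dot u u = x%:C.
  have uE : dot u u = (complex.Re (dot u u))%:C.
    by rewrite RRe_real //; apply: ger0_real; exact: dot_ge0.
  by exists (complex.Re (dot u u)); rewrite // -(lecR 0) -uE dot_ge0.
have [x x0 xE] := RE k; have [y y0 yE] := RE h.
have bnd : `|dot k k| ^+ 2 <= (2 * cnorm a ^+ 2)%:C * ((p%:C * dot k k) * (p%:C * dot h h)).
  apply: le_trans (kern_bound PhiP k h a) _; rewrite ler_wpM2l //.
    by rewrite (lecR 0) mulr_ge0 // sqr_ge0.
  by rewrite /opkern Phi1 ler_pM.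
move: bnd; rewrite ger0_norm ?dot_ge0 // xE yE -rmorphXn -!rmorphM /= lecR => bnd.
rewrite /hnorm xE yE /=; have c0 := cnorm_ge0 a.
have M0 : 0 <= 2 * p * cnorm a by rewrite !mulr_ge0.
rewrite -[leRHS]ger0_norm ?mulr_ge0 ?sqrtr_ge0 // -sqrtr_sqr ler_wsqrtr //.
rewrite exprMn sqr_sqrtr //.
have [x00|xn0] := eqVneq x 0; first by rewrite x00 mulr_ge0 // sqr_ge0.
have xp : 0 < x by rewrite lt_neqAle eq_sym xn0.
rewrite -(ler_pM2l xp) -expr2; apply: le_trans bnd _.
have q0 : 0 <= (p * cnorm a) ^+ 2 * (x * y) by rewrite mulr_ge0 ?sqr_ge0 // mulr_ge0.
lra.
Qed.

End Density.

(** * Convergence in the BW topology *)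

Section BWTopology.
Variables (R : realType) (A : unitalCStarType R).
Variables (H : vectType R[i]) (dot : {dot H for conjC}).
Local Notation C := R[i].
Implicit Types (Phi Psi : A -> 'End(H)).

Lemma cvg_initial (S : choiceType) (T : topologicalType) (f : S -> T)
    (F : set_system S) (s : S) : Filter F ->
  f @ F --> f s -> F --> (s : initial_topology f).
Proof.
move=> FF fF B /= [_ [[D Dop <-] Dfs sDB]].
have : nbhs (f s) D by rewrite nbhsE; exists D.
by move=> /fF FD; apply: (filterS sDB (FD : F (f @^-1` D))).
Qed.

Lemma BW_cvg (G : set_system (A -> 'End(H))) Phi : Filter G ->
  (forall F : predual A dot, clim G (sval F) (sval F Phi)) ->
  G --> (Phi : BW A dot).
Proof.
move=> GF GP; apply: cvg_initial; apply/cvg_sup => F.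
exact: (@cvg_initial _ _ (fun z : predual A dot -> C^o => z F) _ _ _ (GP F)).
Qed.

Lemma BW_cvg_eval (G : set_system (A -> 'End(H))) Phi (F : predual A dot) : Filter G ->
  G --> (Phi : BW A dot) -> clim G (sval F) (sval F Phi).
Proof.
move=> GF GP.
have /cvg_sup/(_ F) h : (@predual_eval R A H dot) @ G --> (@predual_eval R A H dot Phi).
  exact: cvg_trans (cvg_app _ GP) (@initial_continuous _ _ (@predual_eval R A H dot) Phi).
have := @initial_continuous _ _ (fun z : predual A dot -> C^o => z F) (@predual_eval R A H dot Phi).
by move=> h'; apply: cvg_trans (cvg_app _ h) h'.
Qed.

Lemma eval_in_predual u v : @in_predual R A H dot (fun Phi : A -> 'End(H) => dot (Phi 1 u) v).
Proof.
move=> e e0; exists [:: (1, u, v)] => M Phi _ [M0 _].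
by rewrite big_seq1 subrr normr0 (lecR 0) mulr_ge0 // ltW.
Qed.

End BWTopology.

Section Closure.
Variables (R : realType) (A : unitalCStarType R).
Variables (H : vectType R[i]) (dot : {dot H for conjC}).
Variable P : 'End(H).

(** Matrix coefficients at [1] belong to the predual, so a value shared by all of [E] passes to the
    closure. *)
Lemma BW_closure_unit (E : set (A -> 'End(H))) (Phi : A -> 'End(H)) :
  (forall Psi, E Psi -> Psi 1 = P) -> closure (E : set (BW A dot)) Phi -> Phi 1 = P.
Proof.
move=> E1; rewrite closureEcvg => -[G GP [GPhi EG]].
apply: (@op_inj _ _ dot) => u v.
pose F : predual A dot := exist _ _ (@eval_in_predual R A H dot u v).
have L := BW_cvg_eval (F := F) (@filter_filter _ _ GP) GPhi; apply: (clim_unique (FF := GP) L).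
have GE : G E by apply: EG.
apply/climP => e e0; apply: filterS GE => Psi /E1 Psi1 /=.
by rewrite Psi1 subrr normr0 (ltcR 0).
Qed.

Lemma hull_unit E (Phi : A -> 'End(H)) : E `<=` CPP dot P -> Cstar_hull dot P E Phi -> Phi 1 = P.
Proof.
move=> EP [n [T [Psi [_ EPsi Tc ->]]]]; rewrite /Cstar_sum -[RHS]Tc.
by apply: eq_bigr => j _; rewrite (EP _ (EPsi j)).2.
Qed.

Lemma CPP_sub_closure (Phi : A -> 'End(H)) : pos_op dot P -> CPP dot P Phi ->
  closure (Cstar_hull dot P (Cstar_extreme dot P) : set (BW A dot)) Phi.
Proof.
move=> P0 PhiP; set E := Cstar_hull _ _ _.
have [M M0 MP] := CPP_bounded A P0.
(* Hull elements agreeing with [Phi] on ever larger finite sets; [hull_agrees] makes this filter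
   proper. *)
pose G := filter_from [set: seq A] (fun s => [set Psi | [/\ E Psi, CPP dot P Psi &
  forall a, a \in s -> Psi a = Phi a]]).
have GP : ProperFilter G.
  apply: filter_from_proper => [|s _]; last exact: hull_agrees.
  apply: filter_from_filter; first by exists [::].
  move=> s t _ _; exists (s ++ t) => // Psi [EPsi PsiP st].
  by split; split=> // a sa; apply: st; rewrite mem_cat sa ?orbT.
rewrite closureEcvg; exists G => //; split; last first.
  by move=> B EB; exists [::] => // Psi [EPsi _ _]; exact: EB.
apply: BW_cvg => -[F FP] /=; apply/climP => e e0.
(* [Phi] and [Psi] share the finite sum, so [F] separates them by at most 2 M e / (2 M + 1), which
   is below [e]. *)
have d0 : 0 < e / (2 * M + 1) by rewrite divr_gt0 // ltr_wpDl // mulr_ge0.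
have [s sP] := FP _ d0; exists [seq x.1.1 | x <- s] => // Psi [_ PsiP PsiPhi] /=.
have [PhiL _] := PhiP.1; have [PsiL _] := PsiP.1.
have h1 := sP M Phi PhiL (MP _ PhiP); have h2 := sP M Psi PsiL (MP _ PsiP).
have E2 : \sum_(x <- s) dot (Psi x.1.1 x.1.2) x.2 = \sum_(x <- s) dot (Phi x.1.1 x.1.2) x.2.
  rewrite !big_seq; apply: eq_bigr => x xs; rewrite PsiPhi //.
  by apply/mapP; exists x.
rewrite E2 in h2; apply: le_lt_trans (ler_distD (\sum_(x <- s) dot (Phi x.1.1 x.1.2) x.2) _ _) _.
rewrite [X in _ + X]distrC; apply: le_lt_trans (lerD h1 h2) _.
rewrite -rmorphD /= ltcR -mulrDr mulrAC ltr_pdivrMr ?ltr_wpDl ?mulr_ge0 //.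
by rewrite ltr_pM2l //; lra.
Qed.

End Closure.

Theorem corollary3p26 (R : realType) (A : unitalCStarType R)
  (H : vectType R[i]) (dot : {dot H for conjC}) (P : 'End(H)) :
  pos_op dot P ->
  @CPP R A H dot P =
    BW_closure_in_CP dot (Cstar_hull dot P (Cstar_extreme dot P)).
Proof.
move=> P0; apply/seteqP; split=> [Phi PhiP|Phi [Phicp Phicl]].
  by split; [exact: PhiP.1 | exact: CPP_sub_closure].
split=> //; apply: BW_closure_unit Phicl => Psi.
by apply: hull_unit => Z [].
Qed.
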